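(* Let $\mathfrak{g}_{\mathbb{Z}}$ be a Chevalley order (as defined in the context) of an $F$-split reductive Lie algebra $\mathfrak{g}$ over a field $F$ of characteristic zero, let $R$ be a commutative ring, and put $\mathfrak{g}_R:=R\otimes_{\mathbb{Z}}\mathfrak{g}_{\mathbb{Z}}$. If $2$ and $3$ are invertible in $R$, then $$\ker\Big(\bigwedge^2\mathfrak{g}_R\xrightarrow{\ [\;,\;]\ }\mathfrak{g}_R\Big)=\bigwedge\mathfrak{g}_R,$$ where $\bigwedge\mathfrak{g}_R\subseteq\bigwedge^2\mathfrak{g}_R$ is the $R$-submodule generated by all $x\wedge y$ with $x,y\in\mathfrak{g}_R$ and $[x,y]=0$.
   Context: Let $F$ be a field of characteristic zero, $\mathfrak{g}$ an $F$-split reductive Lie algebra with center $\mathfrak{z}$, $\mathfrak{h}\subseteq\mathfrak{g}$ an $F$-split Cartan subalgebra, and $\Phi\subseteq\mathfrak{h}^*$ the corresponding root system. For $\alpha\in\Phi$ the root space $\mathfrak{g}^\alpha$ is one dimensional, and $[\mathfrak{g}^\alpha,\mathfrak{g}^{-\alpha}]$ is one dimensional and contains a unique element $H_\alpha$ with $\alpha(H_\alpha)=2$. Fix a Chevalley system for $(\mathfrak{g},\mathfrak{h})$ (in the sense of Bourbaki, Lie Groups and Lie Algebras, Chap. VIII): nonzero vectors $X_\alpha\in\mathfrak{g}^\alpha$ ($\alpha\in\Phi$) with $[X_\alpha,X_{-\alpha}]=-H_\alpha$ such that the linear map of $\mathfrak{g}$ equal to $-1$ on $\mathfrak{h}$ and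 sending $X_\alpha$ to $X_{-\alpha}$ for all $\alpha$ is a Lie algebra automorphism. Put $Q^\vee:=\sum_{\alpha\in\Phi}\mathbb{Z}H_\alpha$ and $P^\vee:=\{h\in\sum_{\alpha\in\Phi}\mathbb{Q}H_\alpha:\beta(h)\in\mathbb{Z}\text{ for all }\beta\in\Phi\}$. Fix a $\mathbb{Z}$-lattice $\mathfrak{h}_{\mathbb{Z}}\subseteq\mathfrak{h}$ (the $\mathbb{Z}$-span of an $F$-basis of $\mathfrak{h}$) with $Q^\vee\subseteq\mathfrak{h}_{\mathbb{Z}}\subseteq P^\vee\oplus\mathfrak{z}$. The associated Chevalley order is the $\mathbb{Z}$-Lie subalgebra $\mathfrak{g}_{\mathbb{Z}}:=\mathfrak{h}_{\mathbb{Z}}+\sum_{\alpha\in\Phi}\mathbb{Z}X_\alpha$ of $\mathfrak{g}$. Exterior squares are over $R$. *)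

(* Defs.v *)
From HB Require Import structures.
From mathcomp Require Import all_boot all_order all_algebra.

Set Implicit Arguments.
Unset Strict Implicit.
Unset Printing Implicit Defensive.

Import GRing.Theory.
Local Open Scope ring_scope.

(* Coefficient rings are [comPzRingType]: the zero ring is allowed. *)
HB.mixin Record Lmodule_isLieAlgebra (R : comPzRingType) L
    of GRing.Lmodule R L := {
  lie : L -> L -> L;
  lie_linearl : forall y, linear (fun x => lie x y);
  lie_linearr : forall x, linear (lie x);
  liexx : forall x, lie x x = 0;
  lie_jacobi : forall x y z,
    lie x (lie y z) + lie y (lie z x) + lie z (lie x y) = 0
}.

#[short(type="lieAlgType")]
HB.structure Definition LieAlgebra (R : comPzRingType) :=
  { L of GRing.Lmodule R L & Lmodule_isLieAlgebra R L }.

#[short(type="vectLieAlgType")]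
HB.structure Definition VectLieAlgebra (F : fieldType) :=
  { L of Vector F L & Lmodule_isLieAlgebra F L }.

Section LieLinear.
Variables (R : comPzRingType) (L : lieAlgType R).
Implicit Types x y : L.

HB.instance Definition _ x :=
  GRing.isLinear.Build R L L _ (@lie R L x) (@lie_linearr R L x).

Lemma lieDl x1 x2 y : lie (x1 + x2) y = lie x1 y + lie x2 y.
Proof. by have := lie_linearl y 1 x1 x2; rewrite /= !scale1r. Qed.

Lemma lie0l y : lie 0 y = 0.
Proof. by apply: (@addrI _ (lie 0 y)); rewrite -lieDl !addr0. Qed.

Lemma lieZl (a : R) x y : lie (a *: x) y = a *: lie x y.
Proof. by have := lie_linearl y a x 0; rewrite /= lie0l !addr0. Qed.

Lemma lie_suml I (r : seq I) (P : pred I) (E : I -> L) y :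
  lie (\sum_(i <- r | P i) E i) y = \sum_(i <- r | P i) lie (E i) y.
Proof.
by apply: (big_morph (fun x => lie x y)) => [x1 x2|]; rewrite ?lieDl ?lie0l.
Qed.

End LieLinear.

(* [combination act S v]: v is a finite sum of terms [act c x] with x in S. *)
Definition combination (V : nmodType) (A : Type) (act : A -> V -> V)
    (S : V -> Prop) (v : V) : Prop :=
  exists n (c : 'I_n -> A) (x : 'I_n -> V),
    (forall i, S (x i)) /\ v = \sum_i act (c i) (x i).

Definition lin_span (R : pzRingType) (V : lmodType R) :=
  combination (fun (a : R) (v : V) => a *: v).

Definition int_span (V : zmodType) :=
  combination (fun (n : int) (v : V) => v *~ n).

Definition rat_span (F : fieldType) (V : lmodType F) :=
  combination (fun (q : rat) (v : V) => ratr q *: v).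

Section LieTheory.
Variables (F : fieldType) (g : vectLieAlgType F).
Implicit Types (x y : g) (U V W h : {vspace g}).

Definition ad x : 'End(g) := linfun (lie x).

Lemma adE x y : ad x y = lie x y.
Proof. exact: lfunE. Qed.

(* [U, V], the subspace spanned by all brackets (see lie_prodP). *)
Definition lie_prod U V : {vspace g} :=
  <<[seq lie x y | x <- vbasis U, y <- vbasis V]>>%VS.

Lemma lie_prodP U V W :
  reflect (forall x y, x \in U -> y \in V -> lie x y \in W)
          (lie_prod U V <= W)%VS.
Proof.
apply: (iffP span_subvP) => [sW x y xU yV | sW v /allpairsP[[x y] /= [xU yV ->]]].
  rewrite (coord_vbasis xU) lie_suml memv_suml // => i _.
  rewrite lieZl memvZ // (coord_vbasis yV) linear_sum memv_suml // => j _.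
  rewrite linearZ /= memvZ //; apply: sW; apply/allpairsP.
  by exists ((vbasis U)`_i, (vbasis V)`_j); rewrite !mem_nth ?size_tuple.
by apply: sW; apply: vbasis_mem.
Qed.

Definition is_subalgebra U : Prop := (lie_prod U U <= U)%VS.

Definition is_ideal U : Prop := (lie_prod fullv U <= U)%VS.

(* Complete reducibility of the adjoint representation. *)
Definition is_reductive : Prop :=
  forall U, is_ideal U ->
    exists V, [/\ is_ideal V, (U + V)%VS = fullv & (U :&: V)%VS = 0%VS].

Definition in_center x : Prop := forall y, lie x y = 0.

Definition is_nilpotent U : Prop :=
  exists n, iter n (lie_prod U) U = 0%VS.

Definition is_self_normalizing U : Prop :=
  forall x, (forall y, y \in U -> lie x y \in U) -> x \in U.

Definition is_cartan h : Prop :=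
  [/\ is_subalgebra h, is_nilpotent h & is_self_normalizing h].

Definition is_diagonalizable (f : 'End(g)) : Prop :=
  exists s : seq F, (\sum_(a <- s) passmx.leigenspace f a)%VS = fullv.

Definition is_split_cartan h : Prop :=
  is_cartan h /\ (forall x, x \in h -> is_diagonalizable (ad x)).

Definition dual h := 'Hom(subvs_of h, F^o).

(* The common eigenspace of weight alpha (see root_spaceP). *)
Definition root_space h (alpha : dual h) : {vspace g} :=
  (\bigcap_(t <- vbasis {:subvs_of h})
     passmx.leigenspace (ad (vsval t)) (alpha t))%VS.

Lemma root_spaceP h (alpha : dual h) x :
  reflect (forall t : subvs_of h, lie (vsval t) x = (alpha t : F) *: x)
          (x \in root_space alpha).
Proof.
have eigP t : (x \in passmx.leigenspace (ad (vsval t)) (alpha t))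
              = (lie (vsval t) x == (alpha t : F) *: x).
  rewrite /passmx.leigenspace memv_ker add_lfunE opp_lfunE scale_lfunE id_lfunE adE.
  by rewrite subr_eq0.
rewrite /root_space memvE big_tnth.
apply: (iffP subv_bigcapP) => [Hx t | Hx i _]; last first.
  by rewrite -memvE eigP Hx.
rewrite (coord_vbasis (memvf t)) !linear_sum /= lie_suml.
rewrite scaler_suml; apply: eq_bigr => i _; rewrite !linearZ /= lieZl.
have := Hx (cast_ord (esym (size_tuple _)) i) isT.
rewrite -memvE eigP (tnth_nth 0) /= => /eqP ->.
by rewrite scalerA.
Qed.

Definition is_root h (alpha : dual h) : Prop :=
  alpha != 0 /\ root_space alpha != 0%VS.

(* t is the element H_alpha. *)
Definition is_coroot h (alpha : dual h) (t : subvs_of h) : Prop :=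
  vsval t \in lie_prod (root_space alpha) (root_space (- alpha))
  /\ alpha t = 2%:R.

(* Families indexed by Phi are total functions on the dual of h; their values
   outside Phi are never used. *)
Record is_chevalley_system h (H : dual h -> subvs_of h) (X : dual h -> g) :
    Prop := {
  chevalley_neq0 : forall alpha, is_root alpha -> X alpha != 0;
  chevalley_mem : forall alpha, is_root alpha -> X alpha \in root_space alpha;
  chevalley_lie : forall alpha, is_root alpha ->
    lie (X alpha) (X (- alpha)) = - vsval (H alpha);
  chevalley_aut : exists theta : 'End(g),
    [/\ forall x, x \in h -> theta x = - x,
        forall alpha, is_root alpha -> theta (X alpha) = X (- alpha),
        forall x y, theta (lie x y) = lie (theta x) (theta y)
      & bijective theta]
}.

Definition coroot_lattice h (H : dual h -> subvs_of h) : subvs_of h -> Prop :=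
  int_span (fun t => exists2 alpha, is_root alpha & t = H alpha).

Definition coweight_lattice h (H : dual h -> subvs_of h) (t : subvs_of h) :
    Prop :=
  rat_span (fun u => exists2 alpha, is_root alpha & u = H alpha) t
  /\ (forall beta : dual h, is_root beta -> exists n : int, beta t = n%:~R).

Definition is_lattice (V : vectType F) (L : V -> Prop) : Prop :=
  exists b : seq V,
    basis_of fullv b /\ (forall v, L v <-> int_span (fun u => u \in b) v).

Definition chevalley_order h (hZ : subvs_of h -> Prop) (X : dual h -> g)
    (x : g) : Prop :=
  exists (t : subvs_of h) (y : g),
    [/\ hZ t,
        int_span (fun u => exists2 alpha, is_root alpha & u = X alpha) y
      & x = vsval t + y].

End LieTheory.

Definition additive_on (V W : zmodType) (L : V -> Prop) (f : V -> W) : Prop :=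
  forall x y, L x -> L y -> f (x + y) = f x + f y.

(* T is the R-module R (x)_Z L, for an additive subgroup L of V, with i x
   standing for 1 (x) x. *)
Definition is_base_change (R : comPzRingType) (V : zmodType) (L : V -> Prop)
    (T : lmodType R) (i : V -> T) : Prop :=
  additive_on L i
  /\ (forall (M : lmodType R) (f : V -> M), additive_on L f ->
        (exists u : {linear T -> M}, forall x, L x -> u (i x) = f x)
        /\ (forall u v : {linear T -> M},
              (forall x, L x -> u (i x) = v (i x)) -> u =1 v)).

Definition is_alternating (R : comPzRingType) (M N : lmodType R)
    (f : M -> M -> N) : Prop :=
  [/\ forall y, linear (fun x => f x y),
      forall x, linear (f x)
    & forall x, f x x = 0].

(* W is the second exterior power of M over R, with w x y standing for the
   wedge product of x and y. *)
Definition is_exterior_square (R : comPzRingType) (M W : lmodType R)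
    (w : M -> M -> W) : Prop :=
  is_alternating w
  /\ (forall (N : lmodType R) (f : M -> M -> N), is_alternating f ->
        (exists u : {linear W -> N}, forall x y, u (w x y) = f x y)
        /\ (forall u v : {linear W -> N},
              (forall x y, u (w x y) = v (w x y)) -> u =1 v)).

(* Main.v *)
Require Import Defs.
From HB Require Import structures.
From Stdlib Require Import ClassicalEpsilon.
From mathcomp Require Import all_boot all_order all_algebra.
From mathcomp Require Import ring zify.

Set Implicit Arguments.
Unset Strict Implicit.
Unset Printing Implicit Defensive.

Import Order.TTheory GRing.Theory Num.Theory passmx.
Local Open Scope ring_scope.

(** The bracket kills every wedge of two commuting elements, so the point is
    that its kernel is no larger.  Everything happens modulo [comm_span], the
    span of these wedges.  Over [R] the algebra is a torus plus the lines of
    the root vectors [x_alpha].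

    Nonzero weight.  Let [sigma] be the linear map that kills the torus and
    sends [x_alpha] to half of the wedge of [H_alpha] and [x_alpha].  Up to
    [comm_span], a wedge of two weight vectors whose weights do not add up to
    zero is [sigma] of their bracket.  For a torus element [t] and [x_alpha]
    this is the splitting of [t] into a multiple of [H_alpha] and an element
    that commutes with [x_alpha].  For [x_alpha] and [x_beta] with
    [alpha + beta] a root, pick [t] in the torus with [beta t = 0] and
    [alpha t] a unit; the pair [(t, x_beta)] commutes, hence so do its
    conjugates under [exp (s x_alpha)], and the part of their wedge that is
    linear in [s] says that [(alpha t)] times the wedge of [x_alpha] and
    [x_beta] is congruent to the wedge of [t] and their bracket.  The values 1, -1
    and 2 of [s] isolate that part when 6 is invertible
    ([wedge_derivation]).  The outcome is [split_wedge_all]: modulo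
    [comm_span], the wedge of [v] and [w] is [sigma (lie v w)] plus a combination
    of the elements [z_alpha], the wedges of [x_alpha] and [x_(- alpha)].

    Weight zero.  The images [- H_alpha] of the [z_alpha] may satisfy more
    linear relations over [R] than over the integers, since the lattice of the
    torus need not be spanned by the coroots; a weight argument is not enough.
    If [beta], [gamma] and [delta = beta + gamma] are roots, conjugating a
    commuting pair [(t, x_(- delta))] by [exp x_gamma] and then by [exp x_beta]
    gives a commuting pair whose weight zero part is a unit times [z_delta]
    plus multiples of [z_beta] and [z_gamma] ([simple_mod_triangle]).  By
    induction on the height, all [z_alpha] reduce to those of simple roots.
    Finally, if the combination [sum d_alpha z_alpha] over the simple roots is
    killed by the bracket, then [sum d_alpha x_alpha] and [sum x_(- alpha)]
    commute, because a difference of distinct simple roots is not a root, and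
    their wedge is that combination up to commuting wedges
    ([simple_kernel]).

    The coefficients that have to be units are products of structure constants
    and of numbers [4 - <beta, alpha> <alpha, beta>].  That they are small nonzero
    integers is classical root theory, which the sl2-triples given by the
    coroots are enough to develop: root spaces are lines, strings have at most
    four terms, the two Cartan integers of a pair of nonproportional roots have
    a product between 0 and 3 ([cart_prod]), and the structure constants of a
    Chevalley system are 1, 2, 3 up to sign ([structure_constant]).  The last
    fact also makes the Chevalley order closed under the bracket. *)

(** * Linear combinations *)

Section LinearTerms.
Variables (R : pzRingType) (M : lmodType R).

(** Syntax of linear combinations, for proofs by reflection: an identity in a
    module becomes a list of identities between coefficients. *)
Inductive linear_term :=
  | LAtom of nat
  | LZero
  | LAdd of linear_term & linear_term
  | LOpp of linear_term
  | LScale of R & linear_term.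

Fixpoint term_value (e : seq M) (t : linear_term) : M :=
  match t with
  | LAtom n => e`_n
  | LZero => 0
  | LAdd t1 t2 => term_value e t1 + term_value e t2
  | LOpp t1 => - term_value e t1
  | LScale a t1 => a *: term_value e t1
  end.

Fixpoint term_coef (t : linear_term) (k : nat) : R :=
  match t with
  | LAtom n => if eqn n k then 1 else 0
  | LZero => 0
  | LAdd t1 t2 => term_coef t1 k + term_coef t2 k
  | LOpp t1 => - term_coef t1 k
  | LScale a t1 => a * term_coef t1 k
  end.

Lemma term_valueE e t : term_value e t = \sum_(k < size e) term_coef t k *: e`_k.
Proof.
elim: t => [n||t1 IH1 t2 IH2|t1 IH1|a t1 IH1] /=.
- have [n_e|e_n] := ltnP n (size e).
    rewrite (bigD1 (Ordinal n_e)) //= -[eqn n n]/(n == n) eqxx scale1r big1 ?addr0 // => k.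
    by rewrite -val_eqE /= -[eqn n k]/(n == k) eq_sym => /negPf ->; rewrite scale0r.
  rewrite nth_default // big1 // => k _; rewrite -[eqn n k]/(n == k).
  by rewrite gtn_eqF ?scale0r // (leq_trans _ e_n).
- by rewrite big1 // => k _; rewrite scale0r.
- by rewrite IH1 IH2 -big_split; apply: eq_bigr => k _; rewrite scalerDl.
- by rewrite IH1 -sumrN; apply: eq_bigr => k _; rewrite scaleNr.
by rewrite IH1 scaler_sumr; apply: eq_bigr => k _; rewrite scalerA.
Qed.

Lemma term_value_eq e t1 t2 :
  foldr (fun k P => term_coef t1 k = term_coef t2 k /\ P) True (iota 0 (size e)) ->
  term_value e t1 = term_value e t2.
Proof.
move=> coefs; rewrite !term_valueE; apply: eq_bigr => k _; congr (_ *: _).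
have: nat_of_ord k \in iota 0 (size e) by rewrite mem_iota ltn_ord.
by elim: (iota _ _) coefs => //= n s IHs [nE /IHs]; rewrite inE => + /orP[/eqP ->|].
Qed.

End LinearTerms.

Ltac atom_index x e :=
  match e with
  | ?y :: ?e' =>
    match constr:(tt) with
    | _ => let _ := match constr:(tt) with _ => constr_eq x y end in constr:(0%N)
    | _ => let n := atom_index x e' in constr:(n.+1)
    end
  end.

Ltac add_atoms t e :=
  lazymatch t with
  | (?a + ?b)%R => let e' := add_atoms a e in add_atoms b e'
  | (- ?a)%R => add_atoms a e
  | (_ *: ?a)%R => add_atoms a e
  | 0%R => e
  | _ => match constr:(tt) with
         | _ => let _ := atom_index t e in e
         | _ => constr:(t :: e)
         end
  end.

Ltac reify_linear R t e :=
  lazymatch t with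
  | (?a + ?b)%R =>
    let a' := reify_linear R a e in let b' := reify_linear R b e in constr:(LAdd a' b')
  | (- ?a)%R => let a' := reify_linear R a e in constr:(LOpp a')
  | (?c *: ?a)%R => let a' := reify_linear R a e in constr:(@LScale R c a')
  | 0%R => constr:(LZero R)
  | _ => let n := atom_index t e in constr:(@LAtom R n)
  end.

(** Identities between linear combinations: both sides are compared coefficient
    by coefficient, each comparison being an identity in the scalar ring. *)
Ltac linear_coefs R :=
  lazymatch goal with
  | |- @eq ?M ?a ?b =>
    let e := add_atoms a (@nil M) in let e := add_atoms b e in
    let ta := reify_linear R a e in let tb := reify_linear R b e in
    change (term_value e ta = term_value e tb);
    apply: term_value_eq;
    cbn [foldr iota size term_coef eqn];
    repeat (split; [ | ]); try exact: I
  end.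

Ltac linear_combination R := linear_coefs R; ring.

Section Combination.

Section Additive.
Variables (V : nmodType) (A : Type) (act : A -> V -> V) (S : V -> Prop).

Lemma combination0 : combination act S 0.
Proof.
exists 0%N, (fun i : 'I_0 => False_rect A (elimF idP (ltn0 i) (ltn_ord i))), (fun=> 0).
by split; [case | rewrite big_ord0].
Qed.

Lemma combinationD v w : combination act S v -> combination act S w ->
  combination act S (v + w).
Proof.
move=> [m [c [x [Sx ->]]]] [n [d [y [Sy ->]]]]; exists (m + n)%N.
exists (fun k => match split k with inl i => c i | inr j => d j end).
exists (fun k => match split k with inl i => x i | inr j => y j end).
split=> [k|]; first by case: (split k).
rewrite big_split_ord /=; congr (_ + _); apply: eq_bigr => k _.
  by rewrite -[lshift n k]/(unsplit (inl k)) unsplitK.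
by rewrite -[rshift m k]/(unsplit (inr k)) unsplitK.
Qed.

Lemma combination_sum I (r : seq I) (P : pred I) (v : I -> V) :
  (forall i, P i -> combination act S (v i)) -> combination act S (\sum_(i <- r | P i) v i).
Proof. by move=> vS; apply: big_ind => //; [apply: combination0 | apply: combinationD]. Qed.

Lemma combination_gen a v : S v -> combination act S (act a v).
Proof.
move=> Sv; exists 1%N, (fun=> a), (fun=> v); split=> //.
by rewrite big_ord_recl big_ord0 addr0.
Qed.

End Additive.

Lemma lin_span_gen (R : pzRingType) (V : lmodType R) (S : V -> Prop) v : S v -> lin_span S v.
Proof.
by move=> /(combination_gen (fun (a : R) (v : V) => a *: v) 1); rewrite scale1r.
Qed.

Lemma lin_spanZ (R : pzRingType) (V : lmodType R) (S : V -> Prop) a v :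
  lin_span S v -> lin_span S (a *: v).
Proof.
move=> [n [c [x [Sx ->]]]]; rewrite scaler_sumr; apply: combination_sum => i _.
by rewrite scalerA; apply: (combination_gen (fun (a : R) (v : V) => a *: v)).
Qed.

Lemma int_span_gen (V : zmodType) (S : V -> Prop) v : S v -> int_span S v.
Proof. by move=> /(combination_gen (fun (n : int) (v : V) => v *~ n) 1). Qed.

Lemma int_spanZ (V : zmodType) (S : V -> Prop) (a : int) v :
  int_span S v -> int_span S (v *~ a).
Proof.
move=> [n [c [x [Sx ->]]]]; rewrite mulrz_suml; apply: combination_sum => i _.
by rewrite -mulrzA; apply: (combination_gen (fun (n : int) (v : V) => v *~ n)).
Qed.

End Combination.

(** * Weight spaces of a split Cartan subalgebra *)

Section Eigenbasis.
Variables (F : fieldType) (g : vectLieAlgType F).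
Local Notation n := (\dim {:g}).

(** Commuting diagonalizable matrices are simultaneously diagonalizable; the rest
    is a translation between endomorphisms and matrices in a basis. *)
Lemma common_eigenbasis (fs : seq 'End(g)) :
    {in fs, forall f : 'End(g), is_diagonalizable f} ->
    {in fs &, forall f1 f2 : 'End(g), forall x, f1 (f2 x) = f2 (f1 x)} ->
  exists B : n.-tuple g, basis_of fullv B /\
    {in fs, forall f : 'End(g), forall k : 'I_n, exists a, f B`_k = a *: B`_k}.
Proof.
move=> fs_diag fs_comm; pose e := vbasis (fullv : {vspace g}).
have eB : basis_of fullv e := vbasisP _.
pose As := [seq mxof e e f | f <- fs].
have /codiagonalizableP [P Pu /allP PD] :
  {in As &, forall A B, comm_mx A B} /\ {in As, forall A, diagonalizable A}.
  split=> [_ _ /mapP[f1 f1s ->] /mapP[f2 f2s ->]|_ /mapP[f fs_f ->]].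
    rewrite /comm_mx -!mxof_comp //; congr mxof.
    by apply/lfunP=> x; rewrite !comp_lfunE fs_comm.
  apply/diagonalizablePeigen; have [s sf] := fs_diag f fs_f.
  exists (undup s); first exact: undup_uniq.
  apply/eqmxP; rewrite submx1 /=; apply/rV_subP=> u _.
  have: vecof e u \in (\sum_(a <- s) leigenspace f a)%VS.
    by rewrite sf memvf.
  rewrite -[X in (X <= _)%MS](vecofK eB).
  move: (vecof e u) => {u} v.
  elim: s v {sf} => [|a s IHs] v /=.
    by rewrite big_nil memv0 => /eqP ->; rewrite linear0 sub0mx.
  rewrite big_cons => /memv_addP[x xa [y ys ->]]; rewrite linearD /=.
  have {}IHs := IHs _ ys.
  have xa' : (rVof e x <= eigenspace (mxof e e f) a)%MS.
    by rewrite rVof_sub // -leigenspaceE.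
  case: ifP => a_s.
    apply: addmx_sub IHs; apply: submx_trans xa' _.
    have ia : (index a (undup s) < size (undup s))%N by rewrite index_mem mem_undup.
    by rewrite (big_nth 0) big_mkord (sumsmx_sup (Ordinal ia)) //= nth_index ?mem_undup.
  rewrite big_cons; apply: addmx_sub_adds => //.
pose b k := vecof e (row k P).
have size_b : size [seq b k | k : 'I_n] == n by rewrite size_image card_ord.
pose B := Tuple size_b; exists B.
have BE (k : 'I_n) : B`_k = b k.
  by rewrite (nth_map k) ?size_enum_ord // nth_ord_enum.
split.
  rewrite basisEdim size_tuple leqnn andbT; apply/subvP=> v _.
  pose c := rVof e v *m invmx P.
  have ->: v = \sum_k c 0 k *: B`_k.
    rewrite -[LHS](rVofK eB) -[X in vecof e X](mulmxKV Pu) -/c.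
    rewrite [c *m P]mulmx_sum_row linear_sum; apply: eq_bigr => k _.
    by rewrite linearZ /= BE.
  by apply: memv_suml => k _; rewrite memvZ // memv_span // mem_nth ?size_tuple.
move=> f fs_f k; have /PD := map_f (mxof e e) fs_f.
move=> /(diagonalizable_forLR Pu) [D DE]; exists (D 0 k).
rewrite BE /b (hom_vecof e eB) -linearZ /=; congr vecof.
rewrite DE (mxpoly.conjVmx _ Pu) -row_mul // !mulmxA mulmxV // mul1mx row_mul.
by rewrite row_diag_mx -scalemxAl -rowE.
Qed.

End Eigenbasis.

Section LieBasics.
Variables (R : comPzRingType) (L : lieAlgType R).
Implicit Types x y z : L.

Lemma lieC x y : lie x y = - lie y x.
Proof.
have := liexx (x + y); rewrite lieDl !linearD /= !liexx add0r addr0 => /eqP.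
by rewrite addr_eq0 => /eqP.
Qed.

Lemma lieNl x y : lie (- x) y = - lie x y.
Proof. by rewrite -scaleN1r lieZl scaleN1r. Qed.

Lemma lie_derivation x y z : lie x (lie y z) = lie (lie x y) z + lie y (lie x z).
Proof.
have := lie_jacobi x y z; rewrite (lieC z (lie x y)) (lieC z x) linearN /=.
move/eqP; rewrite subr_eq0 => /eqP <-.
by rewrite addrNK.
Qed.

End LieBasics.

Section WeightSpaces.
Variables (F : fieldType) (g : vectLieAlgType F) (h : {vspace g}).
Hypothesis h_split : is_split_cartan h.
Local Notation n := (\dim {:g}).

(** In an eigenbasis the coordinates of [f^m x] are those of [x] times [m]-th
    powers of eigenvalues, which vanish no sooner than the first powers. *)
Lemma diagonalizable_nilpotent (f : 'End(g)) m x :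
  is_diagonalizable f -> iter m f x = 0 -> f x = 0.
Proof.
move=> f_diag; have [] := @common_eigenbasis _ _ [:: f].
- by move=> f1; rewrite inE => /eqP ->.
- by move=> f1 f2; rewrite !inE => /eqP -> /eqP ->.
move=> B [B_basis B_eig].
have {B_eig} /fin_all_exists [a fB] : forall k : 'I_n, exists a, f B`_k = a *: B`_k.
  by apply: B_eig; rewrite inE.
have fE m' : iter m' f x = \sum_k (coord B k x * a k ^+ m') *: B`_k.
  elim: m' => [|m' IHm] /=.
    rewrite {1}(coord_basis B_basis (memvf x)).
    by apply: eq_bigr => k _; rewrite mulr1.
  rewrite IHm linear_sum; apply: eq_bigr => k _.
  by rewrite linearZ /= fB scalerA exprSr mulrA.
rewrite fE -[f x]/(iter 1 f x) fE => f0; apply: big1 => k _.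
have := congr1 (coord B k) f0; rewrite coord_sum_free ?(basis_free B_basis) //.
rewrite linear0 => /eqP; rewrite mulf_eq0 expf_eq0.
by case/orP => [/eqP ->|/andP[_ /eqP ->]]; rewrite ?mul0r ?mulr0 scale0r.
Qed.

(** [ad x] is nilpotent on [h] and diagonalizable, hence zero on [h]. *)
Lemma cartan_abelian (x y : g) : x \in h -> y \in h -> lie x y = 0.
Proof.
have [[_ [m hm] _] h_diag] := h_split => xh yh.
rewrite -adE; apply: (@diagonalizable_nilpotent _ m); first exact: h_diag.
apply/eqP; rewrite -memv0 -hm {hm}; elim: m => [|m IHm] //=.
by rewrite adE; have /lie_prodP := subvv (lie_prod h (iter m (lie_prod h) h)); apply.
Qed.

Lemma lie_ad_comm (x y : g) : lie x y = 0 -> forall z, ad x (ad y z) = ad y (ad x z).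
Proof. by move=> xy0 z; rewrite !adE lie_derivation xy0 lie0l add0r. Qed.

(** The weight of a common eigenvector is read off as its own coordinate in its
    image; this is visibly linear in the element of [h]. *)
Lemma weight_basis :
  exists (B : n.-tuple g) (lam : 'I_n -> dual h),
    basis_of fullv B /\ forall k : 'I_n, B`_k \in root_space (lam k).
Proof.
pose fs := [seq ad (vsval t) | t <- vbasis {: subvs_of h}].
have [] := @common_eigenbasis _ _ fs.
- by move=> _ /mapP[t _ ->]; have [_ h_diag] := h_split; apply/h_diag/subvsP.
- move=> _ _ /mapP[t _ ->] /mapP[u _ ->]; apply: lie_ad_comm.
  by apply: cartan_abelian; apply: subvsP.
move=> B [B_basis B_eig]; exists B.
pose lamf (k : 'I_n) (t : subvs_of h) : F^o := coord B k (lie (vsval t) B`_k).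
have lam_lin k : linear (lamf k).
  by move=> a t u; rewrite /lamf !linearP lieDl lieZl !linearP.
pose lamL k := GRing.isLinear.Build F (subvs_of h) F^o _ (lamf k) (lam_lin k).
pose lam k : {linear subvs_of h -> F^o} := HB.pack (lamf k) (lamL k).
exists (fun k => linfun (lam k)); split=> // k; rewrite /root_space memvE big_tnth.
apply/subv_bigcapP => j _; rewrite -memvE.
set t := tnth _ j.
have [a fB] : exists a, ad (vsval t) B`_k = a *: B`_k.
  by apply: B_eig; apply: map_f; apply: mem_tnth.
have aE : lam k t = a.
  rewrite /= /lamf -adE fB linearZ /= coord_free ?(basis_free B_basis) //.
  by rewrite eqxx mulr1.
rewrite /leigenspace memv_ker add_lfunE opp_lfunE scale_lfunE id_lfunE.
by rewrite fB lfunE -aE subrr.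
Qed.

Lemma lie_root_space (alpha beta : dual h) x y :
  x \in root_space alpha -> y \in root_space beta ->
  lie x y \in root_space (alpha + beta).
Proof.
move=> /root_spaceP xa /root_spaceP yb; apply/root_spaceP => t.
by rewrite lie_derivation xa yb lieZl linearZ /= -scalerDl lfunE.
Qed.

(** An element that commutes with [h] normalizes it. *)
Lemma root_space0 x : (x \in root_space (0 : dual h)) = (x \in h).
Proof.
apply/root_spaceP/idP => [x0|xh t].
  have [[_ _ h_norm] _] := h_split; apply: h_norm => y yh.
  have := x0 (vsproj h y); rewrite vsprojK // lfunE /= scale0r => yx0.
  by rewrite lieC yx0 oppr0 mem0v.
by rewrite lfunE /= scale0r cartan_abelian // subvsP.
Qed.

(** The finite list [rts] and the projections [pi] replace the family of root
    spaces, indexed by the whole dual of [h], in all later sums. *)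
Lemma weight_decomposition :
  exists (rts : seq (dual h)) (pi : dual h -> 'End(g)),
    [/\ uniq rts, forall alpha, is_root alpha <-> alpha \in rts,
        forall alpha x, pi alpha x \in root_space alpha,
        forall alpha beta x, x \in root_space beta ->
          pi alpha x = if alpha == beta then x else 0
      & forall x, x = pi 0 x + \sum_(alpha <- rts) pi alpha x].
Proof.
have [B [lam [B_basis B_wt]]] := weight_basis.
pose pif (alpha : dual h) x := \sum_(k | lam k == alpha) coord B k x *: B`_k.
have pi_lin alpha : linear (pif alpha).
  move=> a x y; rewrite /pif scaler_sumr -big_split /=; apply: eq_bigr => k _.
  by rewrite linearP scalerDl scalerA.
pose piL alpha := GRing.isLinear.Build F g g _ (pif alpha) (pi_lin alpha).
pose pi alpha : {linear g -> g} := HB.pack (pif alpha) (piL alpha).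
have Bk0 (k : 'I_n) : B`_k != 0.
  by rewrite (free_not0 (basis_free B_basis)) // mem_nth ?size_tuple.
have pi_mem alpha x : pi alpha x \in root_space alpha.
  by apply: memv_suml => k /eqP <-; rewrite memvZ.
have pi_root alpha beta x : x \in root_space beta ->
    pi alpha x = if alpha == beta then x else 0.
  move=> /root_spaceP xb.
  have coord0 k : lam k != beta -> coord B k x = 0.
    move=> /eqP neq; apply/eqP/negPn/negP => ck; apply: neq; apply/lfunP => t.
    have := congr1 (coord B k) (xb t).
    rewrite {1}(coord_basis B_basis (memvf x)) linear_sum /=.
    under eq_bigr => j _.
      have /root_spaceP Bj := B_wt j.
      rewrite linearZ /= Bj scalerA; over.
    rewrite coord_sum_free ?(basis_free B_basis) // linearZ /= mulrC.
    by move/(mulIf ck).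
  rewrite /= /pif; case: eqP => [->|neq].
    rewrite [RHS](coord_basis B_basis (memvf x)) [RHS](bigID (fun k => lam k == beta)) /=.
    by rewrite [X in _ = _ + X]big1 ?addr0 // => k kb; rewrite coord0 // scale0r.
  by apply: big1 => k /eqP ka; rewrite coord0 ?scale0r // ka; apply/eqP.
pose rts := [seq alpha <- undup (codom lam) | alpha != 0].
exists rts, (fun alpha => linfun (pi alpha)); split=> //.
- by rewrite filter_uniq ?undup_uniq.
- move=> alpha; rewrite mem_filter mem_undup; split=> [[-> /=]|/andP[a0 /codomP[k ak]]].
    move=> /eqP/vspaceP Va; apply/negPn/negP => alam; apply: Va => x.
    rewrite memv0; apply/idP/eqP => [xa|->]; last exact: mem0v.
    have := pi_root alpha alpha x xa; rewrite eqxx => <-.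
    rewrite /= /pif big1 // => k /eqP ka.
    by case/negP: alam; rewrite -ka codom_f.
  split=> //; apply/eqP => V0; have := B_wt k; rewrite -ak V0 memv0.
  by apply/negP.
- by move=> alpha x; rewrite lfunE.
- by move=> alpha beta x; rewrite lfunE; apply: pi_root.
move=> x; rewrite lfunE; under eq_bigr do rewrite lfunE.
have -> : pi 0 x + \sum_(alpha <- rts) pi alpha x
    = \sum_(alpha <- undup (codom lam)) pi alpha x.
  rewrite big_filter; have [lam0|lam0] := boolP (0 \in codom lam).
    by rewrite (bigD1_seq 0) ?undup_uniq ?mem_undup.
  rewrite [pi 0 x]big1 ?add0r => [|k /eqP k0].
    rewrite big_seq_cond [RHS]big_seq; apply: eq_bigl => alpha.
    rewrite mem_undup andb_idr // => alam.
    by apply: contraNneq lam0 => <-.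
  by case/negP: lam0; rewrite -k0 codom_f.
rewrite /= /pif (exchange_big_dep predT) //= [LHS](coord_basis B_basis (memvf x)).
apply: eq_bigr => k _.
rewrite big_mkcond (bigD1_seq (lam k)) ?undup_uniq ?mem_undup ?codom_f //= eqxx.
by rewrite big1 ?addr0 // => alpha; rewrite eq_sym => /negPf ->.
Qed.

End WeightSpaces.

(** * Truncated exponentials and the exterior square *)

Section TruncatedExponential.
Variables (F : fieldType) (charF : [pchar F] =i pred0) (L : lieAlgType F).
Implicit Types e x y : L.

(** This is [6 exp(ad e)] when the fourth power of [ad e] vanishes.  The factor 6
    clears the denominators, so that Chevalley orders are stable. *)
Definition exp_ad e x : L :=
  6%:R *: x + 6%:R *: lie e x + 3%:R *: lie e (lie e x) + lie e (lie e (lie e x)).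

(** All the iterates of [ad e] on [lie x y] vanish.  In degrees 4 to 6 the
    truncation drops part of their Leibniz expansions, but only terms that
    contain a fourth power of [ad e]. *)
Lemma exp_ad_commute e x y : lie x y = 0 ->
    iter 4 (lie e) x = 0 -> iter 4 (lie e) y = 0 ->
  lie (exp_ad e x) (exp_ad e y) = 0.
Proof.
move=> xy x4 y4; pose b j k := lie (iter j (lie e) x) (iter k (lie e) y).
have bD j k : lie e (b j k) = b j.+1 k + b j k.+1 by rewrite /b lie_derivation.
have b4l k : b 4%N k = 0 by rewrite /b x4 lie0l.
have b4r j : b j 4%N = 0 by rewrite /b y4 linear0.
(* Leibniz expansions of the iterates of ad e on lie x y. *)
have S1 : b 1%N 0%N + b 0%N 1%N = 0 by rewrite -bD /b /= xy linear0.
have S2 : b 2%N 0%N + 2%:R *: b 1%N 1%N + b 0%N 2%N = 0.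
  by rewrite -[RHS](linear0 (lie e)) -S1 linearD /= !bD; linear_combination F.
have S3 : b 3%N 0%N + 3%:R *: b 2%N 1%N + 3%:R *: b 1%N 2%N + b 0%N 3%N = 0.
  by rewrite -[RHS](linear0 (lie e)) -S2 !linearD linearZ /= !bD; linear_combination F.
have S4 : 4%:R *: b 3%N 1%N + 6%:R *: b 2%N 2%N + 4%:R *: b 1%N 3%N = 0.
  rewrite -[RHS](linear0 (lie e)) -S3 !linearD !linearZ /= !bD b4l b4r.
  linear_combination F.
have S5 : 10%:R *: b 3%N 2%N + 10%:R *: b 2%N 3%N = 0.
  rewrite -[RHS](linear0 (lie e)) -S4 !linearD !linearZ /= !bD b4l b4r.
  linear_combination F.
have S6 : 20%:R *: b 3%N 3%N = 0.
  rewrite -[RHS](linear0 (lie e)) -S5 !linearD !linearZ /= !bD b4l b4r.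
  linear_combination F.
have b00 : b 0%N 0%N = 0 by [].
have n20 : 20%:R != 0 :> F by rewrite ((pcharf0P F).1 charF).
(* Twenty times the bracket is an integral combination of these relations. *)
apply: (scalerI n20); rewrite scaler0.
transitivity (720%:R *: b 0%N 0%N + 720%:R *: (b 1%N 0%N + b 0%N 1%N)
  + 360%:R *: (b 2%N 0%N + 2%:R *: b 1%N 1%N + b 0%N 2%N)
  + 120%:R *: (b 3%N 0%N + 3%:R *: b 2%N 1%N + 3%:R *: b 1%N 2%N + b 0%N 3%N)
  + 30%:R *: (4%:R *: b 3%N 1%N + 6%:R *: b 2%N 2%N + 4%:R *: b 1%N 3%N)
  + 6%:R *: (10%:R *: b 3%N 2%N + 10%:R *: b 2%N 3%N) + 20%:R *: b 3%N 3%N).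
  rewrite /exp_ad !lieDl !linearD /= !lieZl !linearZ /= /b /=.
  linear_combination F.
by rewrite b00 S1 S2 S3 S4 S5 S6 !scaler0 !addr0.
Qed.

End TruncatedExponential.

Section ExteriorSquare.
Variables (R : comPzRingType) (L : lieAlgType R) (W : lmodType R) (wedge : L -> L -> W).
Hypothesis wedge_alt : is_alternating wedge.
Implicit Types x y z e t : L.

Definition commuting_wedge (v : W) : Prop := exists x y : L, lie x y = 0 /\ v = wedge x y.

Local Notation comm_span := (lin_span commuting_wedge).

Lemma wedgeDl x x' y : wedge (x + x') y = wedge x y + wedge x' y.
Proof. by have [/(_ y 1 x x')] := wedge_alt; rewrite /= !scale1r. Qed.

Lemma wedgeDr x y y' : wedge x (y + y') = wedge x y + wedge x y'.
Proof. by have [_ /(_ x 1 y y')] := wedge_alt; rewrite /= !scale1r. Qed.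

Lemma wedge0l y : wedge 0 y = 0.
Proof. by apply: (@addrI _ (wedge 0 y)); rewrite -wedgeDl !addr0. Qed.

Lemma wedge0r x : wedge x 0 = 0.
Proof. by apply: (@addrI _ (wedge x 0)); rewrite -wedgeDr !addr0. Qed.

Lemma wedgeZl a x y : wedge (a *: x) y = a *: wedge x y.
Proof. by have [/(_ y a x 0)] := wedge_alt; rewrite /= wedge0l !addr0. Qed.

Lemma wedgeZr a x y : wedge x (a *: y) = a *: wedge x y.
Proof. by have [_ /(_ x a y 0)] := wedge_alt; rewrite /= wedge0r !addr0. Qed.

Lemma wedgeNl x y : wedge (- x) y = - wedge x y.
Proof. by rewrite -[- x]scaleN1r wedgeZl scaleN1r. Qed.

Lemma wedgexx x : wedge x x = 0.
Proof. by have [_ _ ->] := wedge_alt. Qed.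

Lemma wedgeC x y : wedge x y = - wedge y x.
Proof.
have := wedgexx (x + y); rewrite wedgeDl !wedgeDr !wedgexx add0r addr0 => /eqP.
by rewrite addr_eq0 => /eqP.
Qed.

Lemma wedge_suml I (r : seq I) (P : pred I) (E : I -> L) y :
  wedge (\sum_(i <- r | P i) E i) y = \sum_(i <- r | P i) wedge (E i) y.
Proof.
by apply: (big_morph (fun x => wedge x y)) => [x1 x2|]; rewrite ?wedgeDl ?wedge0l.
Qed.

Lemma wedge_sumr I (r : seq I) (P : pred I) (E : I -> L) x :
  wedge x (\sum_(i <- r | P i) E i) = \sum_(i <- r | P i) wedge x (E i).
Proof.
by apply: (big_morph (wedge x)) => [x1 x2|]; rewrite ?wedgeDr ?wedge0r.
Qed.

Lemma commuting_span x y : lie x y = 0 -> comm_span (wedge x y).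
Proof. by move=> xy; apply: lin_span_gen; exists x, y. Qed.

(** The first order part of the conjugation of the commuting pair [(t, y)] by
    [exp (s e)].  Here [x s] and [Y s] are the two conjugates; their wedge is a
    polynomial in [s] of degree 4, whose constant and leading coefficients are
    themselves wedges of commuting elements. *)
Lemma wedge_derivation (u2 u3 : R) (b : R) t e y : 2%:R * u2 = 1 -> 3%:R * u3 = 1 ->
  lie t e = b *: e -> lie t y = 0 -> iter 4 (lie e) y = 0 ->
  comm_span (wedge t (lie e y) - b *: wedge e y).
Proof.
move=> u2E u3E te ty y4.
pose y1 := lie e y; pose y2 := u2 *: lie e y1; pose y3 := u3 *: lie e y2.
have ey1 : lie e y1 = 2%:R *: y2 by rewrite /y2 scalerA u2E scale1r.
have ey2 : lie e y2 = 3%:R *: y3 by rewrite /y3 scalerA u3E scale1r.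
have ey3 : lie e y3 = 0.
  by rewrite /y3 linearZ /= {1}/y2 !linearZ /= -[lie e (lie e _)]/(iter 4 (lie e) y) y4 !scaler0.
have ty1 : lie t y1 = b *: y1 by rewrite /y1 lie_derivation te ty lieZl linear0 addr0.
have ty2 : lie t y2 = (2%:R * b) *: y2.
  rewrite {1}/y2 linearZ /= lie_derivation te ty1 lieZl linearZ /= ey1.
  have u4E : 4%:R * u2 = 2%:R by rewrite -[RHS]mulr1 -u2E; ring.
  by linear_coefs R; ring: u4E.
have ty3 : lie t y3 = (3%:R * b) *: y3.
  rewrite {1}/y3 linearZ /= lie_derivation te ty2 lieZl ey2 [lie e _]linearZ /= ey2.
  have u9E : 9%:R * u3 = 3%:R by rewrite -[RHS]mulr1 -u3E; ring.
  by linear_coefs R; ring: u9E.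
have ey : lie e y = y1 by [].
clearbody y3 y2 y1.
pose x s := t - (s * b) *: e; pose Y (s : R) := y + s *: y1 + s ^+ 2 *: y2 + s ^+ 3 *: y3.
have xY s : lie (x s) (Y s) = 0.
  rewrite /x /Y lieDl lieNl lieZl !linearD !linearZ /= ty ty1 ty2 ty3 ey ey1 ey2 ey3.
  linear_combination R.
pose P1 := wedge t y1 - b *: wedge e y.
pose P2 := wedge t y2 - b *: wedge e y1.
pose P3 := wedge t y3 - b *: wedge e y2.
have xYE s : wedge (x s) (Y s) = wedge t y + s *: P1 + s ^+ 2 *: P2 + s ^+ 3 *: P3
     - (s ^+ 4 * b) *: wedge e y3.
  rewrite /x /Y wedgeDl wedgeNl wedgeZl !wedgeDr !wedgeZr /P1 /P2 /P3.
  linear_combination R.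
pose u6 := u2 * u3.
have u6E : 6%:R * u6 = 1.
  have -> : 6%:R * u6 = (2%:R * u2) * (3%:R * u3) by rewrite /u6; ring.
  by rewrite u2E u3E mulr1.
rewrite ey -/P1.
(* Interpolation at 1, -1 and 2, the extreme coefficients being known. *)
have -> : P1 = u6 *: (6%:R *: wedge (x 1) (Y 1) + (- 2%:R) *: wedge (x (- 1)) (Y (- 1))
   + (- 1) *: wedge (x 2%:R) (Y 2%:R) + (- 3%:R) *: wedge t y + (- 12%:R * b) *: wedge e y3).
  by rewrite !xYE; linear_coefs R; ring: u6E.
by apply: lin_spanZ; do !apply: combinationD; apply: lin_spanZ; apply: commuting_span.
Qed.

Hypothesis wedge_universal : is_exterior_square wedge.

(** The universal property yields maps out of [W], not generators of [W]. So [W]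
    is compared with matrices: [u] sends a wedge to the antisymmetrized matrix
    of products of coordinates, halved because [v] sums over all pairs [(k, l)]
    and meets each wedge twice.  By uniqueness [v \o u] is the identity. *)
Lemma exterior_spanned (u2 : R) n (E : 'I_n -> L) (c : 'I_n -> {linear L -> R^o}) :
  2%:R * u2 = 1 -> (forall v, v = \sum_k (c k v : R) *: E k) ->
  forall w : W, exists a : 'I_n -> 'I_n -> R,
    w = \sum_k \sum_l a k l *: wedge (E k) (E l).
Proof.
move=> u2E vE w.
pose f x y : 'M[R]_n := \matrix_(k, l) (u2 * ((c k x : R) * c l y - (c l x : R) * c k y)).
have f_alt : is_alternating f.
  split=> [y a x x'|x a y y'|x]; apply/matrixP => k l; rewrite !mxE ?linearP /=.
  - rewrite -![_ *: _]/(_ * _); ring.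
  - rewrite -![_ *: _]/(_ * _); ring.
  by ring.
have [_ /(_ _ f f_alt) [[u uE] _]] := wedge_universal.
pose vf (A : 'M[R]_n) := \sum_k \sum_l A k l *: wedge (E k) (E l).
have vf_lin : linear vf.
  move=> a A B; rewrite /vf scaler_sumr -big_split; apply: eq_bigr => k _ /=.
  rewrite scaler_sumr -big_split; apply: eq_bigr => l _ /=.
  by rewrite !mxE scalerDl scalerA.
pose vL := GRing.isLinear.Build R 'M[R]_n W _ vf vf_lin.
pose v : {linear 'M[R]_n -> W} := HB.pack vf vL.
have [_ /(_ _ wedge wedge_alt) [_ uniq]] := wedge_universal.
have vu x y : v (u (wedge x y)) = wedge x y.
  rewrite uE /= /vf; pose S x y := \sum_k \sum_l ((c k x : R) * c l y) *: wedge (E k) (E l).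
  have SE x' y' : S x' y' = wedge x' y'.
    rewrite {2}(vE x') {2}(vE y') /S wedge_suml; apply: eq_bigr => k _.
    by rewrite wedge_sumr; apply: eq_bigr => l _; rewrite wedgeZl wedgeZr scalerA.
  transitivity (u2 *: (S x y - S y x)).
    rewrite /S -sumrB scaler_sumr; apply: eq_bigr => k _.
    rewrite -sumrB scaler_sumr; apply: eq_bigr => l _.
    by rewrite mxE; linear_combination R.
  rewrite !SE [wedge y x]wedgeC; linear_coefs R; ring: u2E.
have vuE : v \o u =1 idfun by apply: uniq => x y; apply: vu.
by exists (u w); rewrite -[LHS]vuE.
Qed.

End ExteriorSquare.

(** * Root spaces and sl2-triples *)

Section RootSystem.
Variables (F : fieldType) (g : vectLieAlgType F) (h : {vspace g}).
Hypotheses (charF : [pchar F] =i pred0) (h_split : is_split_cartan h).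
Variables (H : dual h -> subvs_of h) (X : dual h -> g).
Hypothesis H_coroot : forall alpha : dual h, is_root alpha -> is_coroot alpha (H alpha).
Hypothesis X_chevalley : is_chevalley_system H X.
Variables (rts : seq (dual h)) (pi : dual h -> 'End(g)).
Hypotheses (rts_uniq : uniq rts) (rtsP : forall alpha, is_root alpha <-> alpha \in rts).
Hypothesis pi_mem : forall alpha x, pi alpha x \in root_space alpha.
Hypothesis pi_root : forall alpha beta x, x \in root_space beta ->
  pi alpha x = if alpha == beta then x else 0.
Hypothesis pi_sum : forall x, x = pi 0 x + \sum_(alpha <- rts) pi alpha x.

Implicit Types (alpha beta gamma delta : dual h) (lam : dual h) (x y z : g).

Lemma intr_eq0F (k : int) : (k%:~R == 0 :> F) = (k == 0).
Proof.
have natF := (pcharf0P F).1 charF.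
case: k => n; first by rewrite -pmulrn natF.
by rewrite NegzE mulrNz oppr_eq0 -pmulrn natF.
Qed.

Lemma intrF_inj (k l : int) : k%:~R = l%:~R :> F -> k = l.
Proof. by move/eqP; rewrite -subr_eq0 -intrB intr_eq0F subr_eq0 => /eqP. Qed.

Lemma mulrz_dual alpha (k : int) : alpha *~ k = k%:~R *: alpha.
Proof. by rewrite scaler_int. Qed.

Lemma mulrz_dual_inj alpha (k l : int) : alpha != 0 -> alpha *~ k = alpha *~ l -> k = l.
Proof.
move=> a0 /eqP; rewrite -subr_eq0 -mulrzBr mulrz_dual scaler_eq0 (negPf a0) orbF.
by rewrite intr_eq0F subr_eq0 => /eqP.
Qed.

Lemma rts_neq0 alpha : alpha \in rts -> alpha != 0.
Proof. by move=> /rtsP []. Qed.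

Lemma X_mem alpha : alpha \in rts -> X alpha \in root_space alpha.
Proof. by move=> /rtsP; apply: chevalley_mem X_chevalley _. Qed.

Lemma X_neq0 alpha : alpha \in rts -> X alpha != 0.
Proof. by move=> /rtsP; apply: chevalley_neq0 X_chevalley _. Qed.

Lemma coroot_root alpha : alpha \in rts -> alpha (H alpha) = 2%:R.
Proof. by move=> /rtsP /H_coroot []. Qed.

Lemma weight_rts alpha x : x \in root_space alpha -> x != 0 -> alpha \in 0 :: rts.
Proof.
move=> xa x0; rewrite inE; apply/orP; have [->|a0] := eqVneq alpha 0; [by left | right].
apply/rtsP; split=> //; apply: contraNneq x0 => Va0.
by rewrite -memv0 -Va0.
Qed.

Lemma root_space_notin alpha x : alpha \notin 0 :: rts -> x \in root_space alpha -> x = 0.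
Proof. by move=> aN xa; apply/eqP; apply: contraNT aN; apply: weight_rts xa. Qed.

(** The coroot lies in the bracket of the two root spaces and is not zero. *)
Lemma rtsN alpha : alpha \in rts -> - alpha \in rts.
Proof.
move=> /rtsP ar; apply/rtsP; split; first by rewrite oppr_eq0; case: ar.
apply/negP => /eqP Va0; have [Hmem aH] := H_coroot ar.
move: Hmem; rewrite Va0.
have /subvP sub0 : (lie_prod (root_space alpha) 0 <= 0)%VS.
  by apply/lie_prodP => x y _; rewrite memv0 => /eqP ->; rewrite linear0 mem0v.
move/sub0; rewrite memv0 => /eqP H0.
have H0' : H alpha = 0 by apply/val_inj.
have := intr_eq0F 2; rewrite -[2%:~R]/(2%:R) -aH H0' linear0 eqxx.
by [].
Qed.

Lemma lie_hX (t : subvs_of h) alpha :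
  alpha \in rts -> lie (vsval t) (X alpha) = (alpha t : F) *: X alpha.
Proof. by move=> /X_mem /root_spaceP. Qed.

Lemma lie_XXN alpha : alpha \in rts -> lie (X alpha) (X (- alpha)) = - vsval (H alpha).
Proof. by move=> /rtsP; apply: chevalley_lie X_chevalley _. Qed.

Lemma coroot_opp alpha : alpha \in rts -> H (- alpha) = - H alpha.
Proof.
move=> ar; apply: val_inj; have := lie_XXN (rtsN ar).
rewrite opprK lieC lie_XXN // linearN /= => /eqP.
by rewrite eqr_opp => /eqP ->.
Qed.

(** In characteristic zero the points of a line are distinct, so they cannot all
    lie in a finite set of weights. *)
Lemma weight_line_leaves (s : seq (dual h)) alpha lam : alpha != 0 ->
  exists2 k : nat, (k <= size s)%N & lam + alpha *~ k \notin s.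
Proof.
move=> a0; pose w (k : nat) := lam + alpha *~ k.
have [/hasP[k]|/hasPn w_s] := boolP (has (fun k => w k \notin s) (iota 0 (size s).+1)).
  by rewrite mem_iota add0n ltnS => ks wk; exists k.
have /uniq_leq_size : uniq [seq w k | k <- iota 0 (size s).+1].
  rewrite map_inj_uniq ?iota_uniq // => k l /addrI /(mulrz_dual_inj a0) kl.
  by case: kl.
case/(_ s _)/negP=> [_ /mapP[k kN ->]|]; first by rewrite -[_ \in _]negbK w_s.
by rewrite size_map size_iota ltnn.
Qed.

(** Let [e] and [f] be [ad X_alpha] and [ad X_(- alpha)].  If [e (f y) = 0], then
    [e (f (e^k y))] is a multiple of [e^k y] by a sum of positive weights, so that
    no [e^k y] vanishes and there are infinitely many weights.  This replaces the
    representation theory of sl2 in the study of root spaces. *)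
Lemma sl2_positive_weight alpha lam y (m : nat) :
  alpha \in rts -> y \in root_space lam -> (0 < m)%N -> (lam (H alpha) : F) = m%:R ->
  lie (X alpha) (lie (X (- alpha)) y) = 0 -> y = 0.
Proof.
move=> ar y_lam m0 lamH efy; apply/eqP/negPn/negP => y0.
pose e := lie (X alpha); pose f := lie (X (- alpha)).
have y_mem k : iter k e y \in root_space (lam + alpha *~ k).
  elim: k => [|k IHk] /=; first by rewrite mulr0z addr0.
  rewrite intS mulrzDr mulr1z addrCA; apply: lie_root_space IHk.
  exact: X_mem.
have Hy k : lie (vsval (H alpha)) (iter k e y) = (m + k.*2)%:R *: iter k e y.
  have /root_spaceP -> := y_mem k.
  rewrite add_lfunE lamH mulrz_dual scale_lfunE coroot_root //.
  by congr (_ *: _); rewrite natrD -muln2 natrM -pmulrn.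
have fe z : f (e z) = e (f z) + lie (vsval (H alpha)) z.
  rewrite /e /f lie_derivation -[lie (X (- alpha)) (X alpha)]opprK -lieC lie_XXN //.
  by rewrite opprK addrC.
have [a a_pos efE] : exists2 a : nat -> nat,
    forall k, (0 < k)%N -> (0 < a k)%N & forall k, e (f (iter k e y)) = (a k)%:R *: iter k e y.
  exists (fun k => \sum_(j < k) (m + j.*2))%N => [[|k] //= _|].
    by rewrite big_ord_recl addn0 addn_gt0 m0.
  elim=> [|k IHk] /=; first by rewrite big_ord0 scale0r.
  by rewrite fe IHk Hy -scalerDl -natrD {1}/e linearZ /= big_ord_recr.
have yN0 k : iter k e y != 0.
  elim: k => [|k IHk] //; apply/eqP => yk0.
  have := fe (iter k e y); rewrite -[e _]/(iter k.+1 e y) yk0 /f linear0.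
  rewrite efE Hy -scalerDl -natrD => /esym/eqP.
  rewrite scaler_eq0 (negPf IHk) orbF ((pcharf0P F).1 charF) !addn_eq0.
  by rewrite (gtn_eqF m0) andbF.
have [k _ /negP] := weight_line_leaves (0 :: rts) lam (rts_neq0 ar).
by apply; apply: weight_rts (y_mem k) (yN0 k).
Qed.

(** Subtract from [x] the multiple of [X alpha] that makes [alpha] vanish on the
    bracket with [X (- alpha)]; the difference is killed by [e f]. *)
Lemma root_space_line alpha x : alpha \in rts -> x \in root_space alpha ->
  exists c, x = c *: X alpha.
Proof.
move=> ar xa; pose t := lie (X (- alpha)) x.
have th : t \in h.
  by rewrite -(root_space0 h_split) -(addNr alpha) lie_root_space ?X_mem ?rtsN.
pose c : F := alpha (vsproj h t) / 2%:R; exists c.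
have two0 : 2%:R != 0 :> F by rewrite ((pcharf0P F).1 charF).
apply/eqP; rewrite -subr_eq0; apply/eqP.
apply: (@sl2_positive_weight alpha alpha _ 2) => //.
- by rewrite rpredB ?memvZ ?X_mem.
- exact: coroot_root.
have ->: lie (X (- alpha)) (x - c *: X alpha) = vsval (vsproj h t - c *: H alpha).
  rewrite linearB linearZ /= [lie _ (X alpha)]lieC lie_XXN // opprK.
  by rewrite !linearE /= vsprojK.
rewrite lieC lie_hX //.
have -> : (alpha (vsproj h t - c *: H alpha) : F) = 0.
  rewrite linearB linearZ /= coroot_root // /c.
  by rewrite -[_ *: _]/(_ * _) divfK // subrr.
by rewrite scale0r oppr0.
Qed.

(** [f] maps the root space of [k alpha] to that of [(k - 1) alpha], which is zero
    or, for [k = 2], the line of [X alpha]; both are killed by [e]. *)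
Lemma no_root_multiple alpha (k : nat) : alpha \in rts -> alpha *~ k.+2 \notin rts.
Proof.
move=> ar; elim: k => [|k IHk]; apply/negP => kr.
  have /negP[] := X_neq0 kr; apply/eqP.
  apply: (@sl2_positive_weight alpha (alpha *~ 2) _ 4) => //; first exact: X_mem.
    by rewrite mulrz_dual scale_lfunE coroot_root // -[_ *: _]/(_ * _) -natrM.
  have [|c ->] := @root_space_line alpha (lie (X (- alpha)) (X (alpha *~ 2))) ar.
    rewrite -[X in root_space X](addKr alpha) -[alpha + alpha]/(alpha *~ 2).
    by apply: lie_root_space; apply: X_mem => //; apply: rtsN.
  by rewrite linearZ /= liexx scaler0.
have /negP[] := X_neq0 kr; apply/eqP.
apply: (@sl2_positive_weight alpha (alpha *~ k.+3) _ (k.+3 * 2)) => //.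
- exact: X_mem.
- by rewrite mulrz_dual scale_lfunE coroot_root // -[_ *: _]/(_ * _) natrM -pmulrn.
rewrite (@root_space_notin (alpha *~ k.+2) (lie (X (- alpha)) _)) ?linear0 //.
  rewrite inE negb_or IHk andbT mulrz_dual scaler_eq0 intr_eq0F.
  by rewrite (negPf (rts_neq0 ar)).
have -> : alpha *~ k.+2 = - alpha + alpha *~ k.+3 by rewrite [in RHS]intS mulrzDr mulr1z addKr.
exact: lie_root_space (X_mem (rtsN ar)) (X_mem kr).
Qed.

Lemma root_multiple alpha (k : int) :
  alpha \in rts -> alpha *~ k \in 0 :: rts -> [\/ k = 0, k = 1 | k = -1].
Proof.
move=> ar; rewrite inE mulrz_dual scaler_eq0 (negPf (rts_neq0 ar)) orbF intr_eq0F.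
case/orP => [/eqP|]; first by constructor 1.
rewrite -mulrz_dual; case: k => [[|[|k]]|[|k]].
- by constructor 1.
- by constructor 2.
- by rewrite (negPf (no_root_multiple _ ar)).
- by constructor 3.
by rewrite NegzE mulrNz -mulNrz (negPf (no_root_multiple _ (rtsN ar))).
Qed.

(** * Root strings and Cartan integers *)

(** For roots this means not proportional, by [root_multiple] and
    [indep_linear]. *)
Definition indep gamma beta := (gamma != beta) && (gamma != - beta).

Lemma indep_sym gamma beta : indep gamma beta = indep beta gamma.
Proof. by rewrite /indep [gamma == beta]eq_sym [beta == - gamma]eq_sym eqr_oppLR. Qed.

Lemma indepNr gamma beta : indep gamma (- beta) = indep gamma beta.
Proof. by rewrite /indep opprK andbC. Qed.

Lemma indep_multiple gamma beta (k : int) :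
  gamma \in rts -> beta \in rts -> indep gamma beta -> gamma != beta *~ k.
Proof.
move=> gr br /andP[gb gNb]; apply/eqP => gE.
have := @root_multiple beta k br; rewrite -gE inE gr orbT.
case=> // k0; move: gE; rewrite k0 => gE.
- by move: gr; rewrite gE mulr0z => /rts_neq0; rewrite eqxx.
- by rewrite gE mulr1z eqxx in gb.
- by rewrite gE mulrN1z eqxx in gNb.
Qed.

Lemma indep_line_neq0 gamma beta (k : int) :
  gamma \in rts -> beta \in rts -> indep gamma beta -> gamma + beta *~ k != 0.
Proof.
by move=> gr br /(indep_multiple (- k) gr br); rewrite mulrNz addr_eq0.
Qed.

Lemma indep_line gamma beta (k : int) :
  gamma \in rts -> beta \in rts -> indep gamma beta -> indep (gamma + beta *~ k) beta.
Proof.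
move=> gr br gb; apply/andP; split.
  have := indep_multiple (1 - k) gr br gb; apply: contra => /eqP gE.
  by rewrite mulrzBr mulr1z -{1}gE addrK.
have := indep_multiple (- 1 - k) gr br gb; apply: contra => /eqP gE.
by rewrite mulrzBr mulrN1z -gE addrK.
Qed.

Lemma lie_XX_nonroot alpha beta x y : x \in root_space alpha -> y \in root_space beta ->
  alpha + beta \notin 0 :: rts -> lie x y = 0.
Proof. by move=> xa yb abN; apply: root_space_notin abN (lie_root_space xa yb). Qed.

(** Induction along the string: [f e] on the line of [gamma] and [e f] on the line
    of [gamma + beta] are the same scalar, and [e f - f e] is minus the weight. *)
Lemma lower_raise (q : nat) gamma beta :
  gamma \in rts -> beta \in rts -> indep gamma beta ->
  (forall k : nat, (k <= q)%N -> gamma + beta *~ k \in rts) ->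
  gamma + beta *~ q.+1 \notin rts ->
  lie (X (- beta)) (lie (X beta) (X gamma))
    = - (q%:R * ((gamma (H beta) : F) + q.+1%:R)) *: X gamma.
Proof.
move=> + br; elim: q gamma => [|q IHq] gamma gr gb in_rts out_rts.
  rewrite mul0r oppr0 scale0r (@lie_XX_nonroot beta gamma (X beta)) ?X_mem ?linear0 //.
  by rewrite addrC inE negb_or (indep_line_neq0 1).
pose delta := gamma + beta.
have dr : delta \in rts by have := in_rts 1%N isT.
have [N eN] : exists N, lie (X beta) (X gamma) = N *: X delta.
  by apply: root_space_line; rewrite // /delta addrC lie_root_space ?X_mem.
have [M fM] : exists M, lie (X (- beta)) (X delta) = M *: X gamma.
  apply: root_space_line => //.
  by rewrite -(addKr beta gamma) [beta + _]addrC lie_root_space ?X_mem ?rtsN.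
have shift (k : int) : delta + beta *~ k = gamma + beta *~ (1 + k).
  by rewrite mulrzDr mulr1z addrA.
have {}IHq := IHq delta dr (indep_line 1 gr br gb).
have {}IHq : lie (X (- beta)) (lie (X beta) (X delta)) =
   - (q%:R * ((delta (H beta) : F) + q.+1%:R)) *: X delta.
  apply: IHq => [k kq|]; rewrite shift -?intS //; exact: in_rts.
have dH : (delta (H beta) : F) = (gamma (H beta) : F) + 2%:R.
  by rewrite lfunE /= coroot_root.
have := lie_derivation (X beta) (X (- beta)) (X delta).
rewrite lie_XXN // lieNl lie_hX // IHq fM -scaleNr -scalerDl.
rewrite linearZ /= eN scalerA => /eqP; rewrite -subr_eq0 -scalerBl scaler_eq0.
rewrite (negPf (X_neq0 dr)) orbF linearZ /= fM scalerA dH subr_eq0 => /eqP NM.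
by congr (_ *: _); rewrite mulrC NM -!natr1; ring.
Qed.

Lemma root_ray gamma beta : gamma \in rts -> beta \in rts ->
  exists q : nat, (forall k : nat, (k <= q)%N -> gamma + beta *~ k \in rts)
    /\ gamma + beta *~ q.+1 \notin rts.
Proof.
move=> gr br; have := weight_line_leaves rts gamma (rts_neq0 br).
case=> k0 _ k0N; have ex : exists k : nat, gamma + beta *~ k \notin rts by exists k0.
case: (ex_minnP ex) => -[|q]; first by rewrite mulr0z addr0 gr.
move=> qN qmin; exists q; split=> // k kq; apply: contraTT kq => /qmin.
by rewrite -ltnNge.
Qed.

(** Computing [f e] from the top of the string and [e f] from its bottom, and
    comparing, gives [(p + q + 1) gamma(H_beta) = (p + q + 1) (p - q)]. *)
Lemma root_string gamma beta : gamma \in rts -> beta \in rts -> indep gamma beta ->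
  exists p q : nat,
    [/\ forall k : int, - p%:Z <= k <= q%:Z -> gamma + beta *~ k \in rts,
        (gamma (H beta) : F) = (p%:Z - q%:Z)%:~R,
        gamma + beta *~ q.+1 \notin rts
      & lie (X (- beta)) (lie (X beta) (X gamma)) = - (q * p.+1)%:R *: X gamma].
Proof.
move=> gr br gb.
have [q [q_in q_out]] := root_ray gr br; have := lower_raise gr br gb q_in q_out.
have [p [p_in p_out]] := root_ray gr (rtsN br).
have gNb : indep gamma (- beta) by rewrite indepNr.
have := lower_raise gr (rtsN br) gNb p_in p_out.
rewrite opprK coroot_opp // [gamma (- _)]linearN /= => efE feE.
have := lie_derivation (X beta) (X (- beta)) (X gamma).
rewrite lie_XXN // lieNl lie_hX // efE feE -scaleNr -scalerDl => /eqP.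
rewrite -subr_eq0 -scalerBl scaler_eq0 (negPf (X_neq0 gr)) orbF => /eqP E.
have mE : (gamma (H beta) : F) = (p%:Z - q%:Z)%:~R.
  apply/eqP; rewrite -subr_eq0.
  have pq0 : (p + q).+1%:R != 0 :> F by rewrite ((pcharf0P F).1 charF).
  rewrite -(mulrI_eq0 _ (mulfI pq0)); apply/eqP; rewrite -[RHS]E.
  by rewrite intrB -!pmulrn -!natr1 natrD; ring.
exists p, q; split=> //; last first.
  by rewrite mE intrB -!pmulrn natrM -!natr1; congr (_ *: _); ring.
case=> k /andP[]; first by move=> _ kq; apply: q_in; lia.
rewrite NegzE => kp _; rewrite mulrNz -mulNrz; apply: p_in; lia.
Qed.

(** A total left inverse of the embedding of the integers, by classical choice. *)
Definition int_val (a : F) : int := epsilon (inhabits 0) (fun k : int => a = k%:~R).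

Lemma int_valK (k : int) : int_val k%:~R = k.
Proof. by apply/esym/intrF_inj/(epsilon_spec _ (fun l : int => _ = l%:~R)); exists k. Qed.

Definition cart gamma beta := int_val (gamma (H beta)).

Lemma cartE gamma beta : gamma \in rts -> beta \in rts ->
  (gamma (H beta) : F) = (cart gamma beta)%:~R.
Proof.
move=> gr br; suff [k kE] : exists k : int, (gamma (H beta) : F) = k%:~R.
  by rewrite /cart kE int_valK.
have [->|gb] := eqVneq gamma beta; first by exists 2; rewrite coroot_root.
have [->|gNb] := eqVneq gamma (- beta).
  by exists (- 2); rewrite opp_lfunE coroot_root // rmorphN.
have [|p [q [_ mE _ _]]] := root_string gr br; first by rewrite /indep gb.
by exists (p%:Z - q%:Z).
Qed.

Lemma cart_self alpha : alpha \in rts -> cart alpha alpha = 2.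
Proof. by move=> ar; apply: intrF_inj; rewrite -cartE // coroot_root. Qed.

Lemma cart_shift gamma beta (k : int) delta :
  gamma \in rts -> beta \in rts -> delta \in rts -> gamma + beta *~ k \in rts ->
  cart (gamma + beta *~ k) delta = cart gamma delta + k * cart beta delta.
Proof.
move=> gr br dr gbr; apply: intrF_inj; rewrite -cartE // mulrz_dual lfunE /=.
by rewrite scale_lfunE !cartE // intrD intrM.
Qed.

Lemma cartNl alpha beta : alpha \in rts -> beta \in rts ->
  cart (- alpha) beta = - cart alpha beta.
Proof.
move=> ar br; apply: intrF_inj; rewrite -cartE ?rtsN // lfunE /= cartE //.
by rewrite intrN.
Qed.

Lemma cart_string gamma beta : gamma \in rts -> beta \in rts -> indep gamma beta ->
  exists p q : nat,
    [/\ forall k : int, - p%:Z <= k <= q%:Z -> gamma + beta *~ k \in rts,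
        cart gamma beta = p%:Z - q%:Z,
        gamma + beta *~ q.+1 \notin rts
      & lie (X (- beta)) (lie (X beta) (X gamma)) = - (q * p.+1)%:R *: X gamma].
Proof.
move=> gr br gb; have [p [q [? mE ? ?]]] := root_string gr br gb.
by exists p, q; split=> //; apply: intrF_inj; rewrite -mE cartE.
Qed.

Lemma cart_reflection gamma beta : gamma \in rts -> beta \in rts ->
  gamma - beta *~ cart gamma beta \in rts.
Proof.
move=> gr br; have [->|gb] := eqVneq gamma beta.
  by rewrite cart_self // mulrz_nat mulr2n opprD addNKr rtsN.
have [->|gNb] := eqVneq gamma (- beta).
  by rewrite cartNl // cart_self // mulrNz opprK mulrz_nat mulr2n addKr.
have [|p [q [in_rts mE _ _]]] := cart_string gr br; first by rewrite /indep gb.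
rewrite -mulrNz; apply: in_rts; lia.
Qed.

(** The Killing form on the coroots. *)
Definition kappa beta gamma : int := \sum_(alpha <- rts) cart alpha beta * cart alpha gamma.

Lemma kappaC beta gamma : kappa beta gamma = kappa gamma beta.
Proof. by apply: eq_bigr => alpha _; rewrite mulrC. Qed.

(** The reflection [s] permutes the roots, so [kappa] is invariant under it, and
    it changes the sign of [H beta]. *)
Lemma kappa_cart beta gamma : beta \in rts -> gamma \in rts ->
  2 * kappa beta gamma = cart beta gamma * kappa beta beta.
Proof.
move=> br gr; pose s alpha := alpha - beta *~ cart alpha beta.
have sr alpha : alpha \in rts -> s alpha \in rts by move=> ar; apply: cart_reflection.
have cart_s alpha delta : alpha \in rts -> delta \in rts ->
    cart (s alpha) delta = cart alpha delta - cart alpha beta * cart beta delta.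
  move=> ar dr; rewrite /s -mulrNz cart_shift ?mulNr //.
  by rewrite mulrNz; apply: sr.
have sK : {in rts, cancel s s}.
  move=> alpha ar; rewrite {1}/s cart_s // cart_self // /s -addrA -opprD -mulrzDr.
  have -> : cart alpha beta + (cart alpha beta - cart alpha beta * 2) = 0 by ring.
  by rewrite mulr0z oppr0 addr0.
have s_perm : perm_eq rts [seq s alpha | alpha <- rts].
  apply: uniq_perm => //; first by rewrite map_inj_in_uniq //; apply: can_in_inj sK.
  move=> alpha; apply/idP/mapP => [ar|[delta dr ->]]; last exact: sr.
  by exists (s alpha); [apply: sr | rewrite sK].
have : kappa beta gamma = - kappa beta gamma + cart beta gamma * kappa beta beta.
  rewrite {1}/kappa (perm_big _ s_perm) big_map mulr_sumr -sumrN -big_split /=.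
  rewrite big_seq [RHS]big_seq; apply: eq_bigr => alpha ar.
  by rewrite !cart_s // cart_self //; ring.
by move=> E; lia.
Qed.

Lemma kappa_gt0 beta : beta \in rts -> 0 < kappa beta beta.
Proof.
move=> br; rewrite /kappa (big_rem beta) //= cart_self //.
rewrite ltr_pwDl // sumr_ge0 // => alpha _; exact: sqr_ge0.
Qed.

Lemma cart_kappa beta gamma : beta \in rts -> gamma \in rts ->
  cart beta gamma * kappa beta beta = cart gamma beta * kappa gamma gamma.
Proof. by move=> br gr; rewrite -!kappa_cart // kappaC. Qed.

(** The Cauchy-Schwarz inequality for [kappa], as an explicit sum of squares. *)
Lemma kappa_sum_squares beta gamma : beta \in rts -> gamma \in rts ->
  \sum_(alpha <- rts) (2 * cart alpha gamma - cart beta gamma * cart alpha beta) ^+ 2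
    = (4 - cart beta gamma * cart gamma beta) * kappa gamma gamma.
Proof.
move=> br gr; set n := cart beta gamma.
transitivity (4 * kappa gamma gamma - 4 * n * kappa beta gamma + n ^+ 2 * kappa beta beta).
  rewrite /kappa !mulr_sumr -sumrB -big_split /=; apply: eq_bigr => alpha _; ring.
have E1 := kappa_cart br gr; have E2 := cart_kappa br gr; rewrite -/n in E1 E2.
have -> : 4 * n * kappa beta gamma = 2 * n * (2 * kappa beta gamma) by ring.
by rewrite E1 expr2 -!mulrA E2; ring.
Qed.

(** Equality in Cauchy-Schwarz would make [gamma - r beta] vanish on all coroots.
    As [r] lies between 0 and [cart gamma beta = 2 r], that is a root of the
    string, and a root does not vanish on its own coroot. *)
Lemma cart_prod_neq4_half beta gamma (r : int) :
  beta \in rts -> gamma \in rts -> indep gamma beta ->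
  cart gamma beta = 2 * r -> cart beta gamma * cart gamma beta <> 4.
Proof.
move=> br gr gb mE mn4; have := kappa_sum_squares br gr; rewrite mn4 subrr mul0r.
move/eqP; rewrite psumr_eq0 => [/allP sq0|alpha _]; last exact: sqr_ge0.
have prop alpha : alpha \in rts -> cart gamma alpha = r * cart beta alpha.
  move=> ar; have := sq0 _ ar; rewrite /= expf_eq0 /= => /eqP E.
  have Eg := cart_kappa ar gr; have Eb := cart_kappa ar br; have En := cart_kappa br gr.
  have kg0 : 2 * kappa gamma gamma != 0 by rewrite mulf_neq0 // gt_eqF ?kappa_gt0.
  apply: (mulIf kg0); rewrite mulrCA -Eg mulrA.
  have -> : 2 * cart alpha gamma = cart beta gamma * cart alpha beta.
    by apply/eqP; rewrite -subr_eq0 E.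
  rewrite -mulrA Eb mulrCA En mE; ring.
have [p [q [in_rts pqE _ _]]] := cart_string gr br gb.
have dr : gamma + beta *~ (- r) \in rts by apply: in_rts; lia.
have := cart_self dr; rewrite cart_shift // !prop //.
lia.
Qed.

(** When the product is 4, one of the two factors is even. *)
Lemma cart_prod beta gamma : beta \in rts -> gamma \in rts -> indep gamma beta ->
  0 <= cart beta gamma * cart gamma beta <= 3.
Proof.
move=> br gr gb; have Ek := cart_kappa br gr.
have kb := kappa_gt0 br; have kg := kappa_gt0 gr.
have ge0 : 0 <= cart beta gamma * cart gamma beta by nia.
have le4 : cart beta gamma * cart gamma beta <= 4.
  rewrite -subr_ge0 -(pmulr_lge0 _ kg) -kappa_sum_squares //.
  by apply: sumr_ge0 => alpha _; apply: sqr_ge0.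
have n4 := @cart_prod_neq4_half beta gamma _ br gr gb.
have gb' : indep beta gamma by rewrite indep_sym.
have n4' := @cart_prod_neq4_half gamma beta _ gr br gb'.
suff : cart beta gamma * cart gamma beta <> 4 by lia.
have [r rE] : exists r : int, cart gamma beta = 2 * r \/ cart gamma beta = 2 * r + 1.
  by exists (cart gamma beta %/ 2)%Z; lia.
have [s sE] : exists s : int, cart beta gamma = 2 * s \/ cart beta gamma = 2 * s + 1.
  by exists (cart beta gamma %/ 2)%Z; lia.
case: rE => [/n4 //|rE]; case: sE => [/n4'|sE]; first by rewrite mulrC.
by rewrite rE sE; nia.
Qed.

Lemma cart_bounds beta gamma : beta \in rts -> gamma \in rts -> indep gamma beta ->
  [/\ -3 <= cart gamma beta <= 3, 0 <= cart beta gamma * cart gamma beta <= 3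
    & (cart gamma beta == 0) = (cart beta gamma == 0)].
Proof.
move=> br gr gb; have mn := cart_prod br gr gb; have Ek := cart_kappa br gr.
have kb := kappa_gt0 br; have kg := kappa_gt0 gr.
have m0 : (cart gamma beta == 0) = (cart beta gamma == 0).
  by apply/eqP/eqP => E; rewrite E mul0r in Ek; nia.
split=> //; have [n0|n0] := eqVneq (cart beta gamma) 0.
  by move: m0; rewrite n0 eqxx => /eqP ->.
nia.
Qed.

(** The finite check behind [N^2 = (p + 1)^2]: here [p - q] and [p' - q'] are the
    two Cartan integers of a pair of roots whose sum is a root. *)
Lemma rank_two_strings (p q p' q' : nat) :
  (0 < q)%N -> (0 < q')%N -> (p + q <= 3)%N -> (p' + q' <= 3)%N ->
  0 <= (p'%:Z - q'%:Z) * (p%:Z - q%:Z) <= 3 ->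
  (p%:Z - q%:Z == 0) = (p'%:Z - q'%:Z == 0) ->
  p%:Z - q%:Z <= 1 -> p'%:Z - q'%:Z <= 1 ->
  (p%:Z - q%:Z) * (q' * p'.+1)%N = (p'%:Z - q'%:Z) * (q * p.+1)%N ->
  (q' * p'.+1)%N%:Z * (2 + (p%:Z - q%:Z)) + (q * p.+1)%N%:Z * (2 + (p'%:Z - q'%:Z))
    = 2 * p.+1%:Z ^+ 2.
Proof.
case: q => [|[|[|[|q]]]] //; case: q' => [|[|[|[|q']]]] //;
case: p => [|[|[|p]]] //; case: p' => [|[|[|p']]] //; lia.
Qed.

(** * Structure constants of the Chevalley system *)

(** The top [gamma + q beta] of the string has Cartan integer [p + q]. *)
Lemma short_string gamma beta :
  gamma \in rts -> beta \in rts -> indep gamma beta -> beta + gamma \in rts ->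
  exists p q : nat,
    [/\ cart gamma beta = p%:Z - q%:Z, (0 < q)%N, (p + q <= 3)%N
      & lie (X (- beta)) (lie (X beta) (X gamma)) = - (q * p.+1)%:R *: X gamma].
Proof.
move=> gr br gb bgr; have [p [q [in_rts mE out_rts feE]]] := cart_string gr br gb.
exists p, q; split=> //.
  by case: q {mE feE in_rts} out_rts => //; rewrite mulr1z addrC bgr.
have gqr : gamma + beta *~ q \in rts by apply: in_rts; clear; lia.
have [] := cart_bounds br gqr (indep_line q gr br gb).
rewrite cart_shift // cart_self // mE; clear; lia.
Qed.

Lemma lie_X_line alpha beta : alpha \in rts -> beta \in rts -> alpha + beta \in rts ->
  exists c, lie (X alpha) (X beta) = c *: X (alpha + beta).
Proof. by move=> ar br abr; apply: root_space_line (lie_root_space (X_mem ar) (X_mem br)). Qed.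

(** The coroot relation is the Jacobi identity for [beta], [gamma] and
    [- (beta + gamma)].  The automorphism of the Chevalley system identifies
    [a] and [b] with constants of the opposite roots, which turns the two double
    brackets into [N a] and [N b]. *)
Lemma structure_constant_relations beta gamma :
  beta \in rts -> gamma \in rts -> indep gamma beta -> beta + gamma \in rts ->
  exists N a b : F,
    [/\ lie (X beta) (X gamma) = N *: X (beta + gamma),
        N *: H (beta + gamma) = a *: H beta + b *: H gamma,
        lie (X (- beta)) (lie (X beta) (X gamma)) = - (N * b) *: X gamma
      & lie (X (- gamma)) (lie (X gamma) (X beta)) = - (N * a) *: X beta].
Proof.
move=> br gr gb bgr; have [theta [_ thetaX thetaM _]] := chevalley_aut X_chevalley.
have thetaE alpha : alpha \in rts -> theta (X alpha) = X (- alpha) by move/rtsP/thetaX.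
set delta := beta + gamma.
have [N NE] : exists N, lie (X beta) (X gamma) = N *: X delta by apply: lie_X_line.
have [a aE] : exists a, lie (X gamma) (X (- delta)) = a *: X (- beta).
  have -> : - beta = gamma + - delta by rewrite /delta opprD addrCA subrr addr0.
  by apply: lie_X_line; rewrite ?rtsN // /delta opprD addrCA subrr addr0 rtsN.
have [b bE] : exists b, lie (X (- delta)) (X beta) = b *: X (- gamma).
  have -> : - gamma = - delta + beta by rewrite /delta opprD addrAC addNr add0r.
  by apply: lie_X_line; rewrite ?rtsN // /delta opprD addrAC addNr add0r rtsN.
have lieXNX alpha : alpha \in rts -> lie (X (- alpha)) (X alpha) = vsval (H alpha).
  by move=> ar; rewrite lieC lie_XXN ?opprK.
exists N, a, b; split=> //.
- apply: subvs_inj; have := lie_jacobi (X beta) (X gamma) (X (- delta)).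
  rewrite aE bE NE ![lie _ (_ *: _)]linearZ /= !lie_XXN // lieXNX // !scalerN.
  by rewrite -opprD addrC => /eqP; rewrite subr_eq0 => /eqP E.
- have /(congr1 theta) := bE; rewrite thetaM linearZ /= !thetaE ?rtsN // !opprK => E.
  by rewrite NE linearZ /= lieC E scalerN scalerA scaleNr.
have /(congr1 theta) := aE; rewrite thetaM linearZ /= !thetaE ?rtsN // !opprK => E.
by rewrite [lie (X gamma) _]lieC NE linearN linearZ /= E scalerA scaleNr.
Qed.

(** The relations give [N b = q (p + 1)] and [N a = q' (p' + 1)]; evaluating roots
    on the coroot relation shows that [2 N^2] is the integer [K] and, through
    [kappa], that [m A = n B].  Then [rank_two_strings] gives
    [N^2 = (p + 1)^2]. *)
Lemma structure_constant beta gamma :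
  beta \in rts -> gamma \in rts -> indep gamma beta -> beta + gamma \in rts ->
  exists N : int, [/\ lie (X beta) (X gamma) = N%:~R *: X (beta + gamma),
    N != 0 & -3 <= N <= 3].
Proof.
move=> br gr gb bgr.
have gb' : indep beta gamma by rewrite indep_sym.
have [N [a [b [NE HE bE aE]]]] := structure_constant_relations br gr gb bgr.
have [p [q [mE q_gt0 pq3 feE]]] := short_string gr br gb bgr.
have [p' [q' [nE q'_gt0 pq3' feE']]] : exists p q : nat,
    [/\ cart beta gamma = p%:Z - q%:Z, (0 < q)%N, (p + q <= 3)%N
      & lie (X (- gamma)) (lie (X gamma) (X beta)) = - (q * p.+1)%:R *: X beta].
  by apply: short_string => //; rewrite addrC.
have Nb : N * b = (q * p.+1)%:R.
  move/eqP: bE; rewrite feE -subr_eq0 -scalerBl scaler_eq0 (negPf (X_neq0 gr)) orbF.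
  by rewrite opprK addrC subr_eq0 => /eqP.
have Na : N * a = (q' * p'.+1)%:R.
  move/eqP: aE; rewrite feE' -subr_eq0 -scalerBl scaler_eq0 (negPf (X_neq0 br)) orbF.
  by rewrite opprK addrC subr_eq0 => /eqP.
pose A : int := (q' * p'.+1)%N; pose B : int := (q * p.+1)%N.
have NH alpha : alpha \in rts ->
    N ^+ 2 * (cart alpha (beta + gamma))%:~R = (A * cart alpha beta + B * cart alpha gamma)%:~R.
  move=> ar; rewrite intrD !intrM -!cartE // -!pmulrn -Na -Nb.
  have := congr1 (fun t => N * (alpha t : F)) HE.
  rewrite linearD !linearZ /= -![_ *: _]/(_ * _) => E.
  by rewrite expr2 -mulrA E; ring.
have cart_sum alpha : alpha \in rts ->
    cart (beta + gamma) alpha = cart beta alpha + cart gamma alpha.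
  by move=> ar; rewrite -[gamma in LHS]mulr1z cart_shift ?mul1r ?mulr1z.
have [m3 mn m0] := cart_bounds br gr gb; have [n3 _ _] := cart_bounds gr br gb'.
have db : cart (beta + gamma) beta <= 3.
  have [] := @cart_bounds beta (beta + gamma) br bgr; last by move=> /andP[].
  by have := indep_line 1 gr br gb; rewrite mulr1z addrC.
have dg : cart (beta + gamma) gamma <= 3.
  have [] := @cart_bounds gamma (beta + gamma) gr bgr; last by move=> /andP[].
  by have := indep_line 1 br gr gb'; rewrite mulr1z.
rewrite !cart_sum // !cart_self // in db dg.
set m := cart gamma beta in mE m3 mn m0 n3 db dg.
set n := cart beta gamma in nE m3 mn m0 n3 db dg.
pose K : int := A * (2 + m) + B * (2 + n).
have NK : N ^+ 2 * 2%:R = K%:~R.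
  have := NH _ bgr; rewrite cart_self // !cart_sum // !cart_self // -/m -/n => ->.
  by congr (_%:~R); rewrite /K; ring.
have KH alpha : alpha \in rts ->
    K * cart alpha (beta + gamma) = 2 * (A * cart alpha beta + B * cart alpha gamma).
  by move=> ar; apply: intrF_inj; rewrite !intrM -NK -NH //; ring.
have [kb kg kd] := And3 (kappa_gt0 br) (kappa_gt0 gr) (kappa_gt0 bgr).
have kmn := cart_kappa br gr; rewrite -/m -/n in kmn.
(* The coroot relation transported to roots by the form kappa. *)
have lin alpha : alpha \in rts ->
    (2 * A * kappa beta beta - K * kappa (beta + gamma) (beta + gamma)) * cart beta alpha
    + (2 * B * kappa gamma gamma - K * kappa (beta + gamma) (beta + gamma)) * cart gamma alpha
    = 0.
  move=> ar; have E1 := cart_kappa ar bgr; have E2 := cart_kappa ar br.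
  have E3 := cart_kappa ar gr; rewrite cart_sum // in E1.
  have : K * (cart alpha (beta + gamma) * kappa alpha alpha)
       = 2 * (A * (cart alpha beta * kappa alpha alpha)
              + B * (cart alpha gamma * kappa alpha alpha)).
    by rewrite mulrA KH //; ring.
  rewrite E1 E2 E3 => E.
  apply/eqP; rewrite -(subrr (K * ((cart beta alpha + cart gamma alpha) *
    kappa (beta + gamma) (beta + gamma)))) [X in _ == X - _]E; apply/eqP; ring.
(* The two equations below have determinant 4 - m n, which is not zero. *)
have mAnB : m * A = n * B.
  have := lin _ br; have := lin _ gr; rewrite !cart_self // -/m -/n.
  set u := _ - _; set v := _ - _ => Eg Eb.
  have u0 : u * (4 - n * m) = 0.
    have -> : u * (4 - n * m) = 2 * (u * 2 + v * m) - m * (u * n + v * 2) by ring.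
    by rewrite Eb Eg; ring.
  have {}u0 : u = 0.
    by move/eqP: u0; rewrite mulf_eq0 => /orP[/eqP //|/eqP]; clear -mn; lia.
  have v0 : v = 0 by move: Eg; rewrite u0 mul0r add0r; clear; lia.
  have kb0 : 2 * kappa beta beta != 0 by rewrite mulf_neq0 // gt_eqF.
  apply: (mulIf kb0).
  have -> : m * A * (2 * kappa beta beta) = m * (2 * A * kappa beta beta) by ring.
  have -> : 2 * A * kappa beta beta = 2 * B * kappa gamma gamma.
    by apply/eqP; rewrite -subr_eq0; apply/eqP; rewrite -[RHS]u0 -[u]subr0 -v0 /u /v; ring.
  have -> : m * (2 * B * kappa gamma gamma) = 2 * B * (m * kappa gamma gamma) by ring.
  by rewrite -kmn; ring.
have KE : K = 2 * p.+1%:Z ^+ 2.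
  rewrite /K /A /B; rewrite mE nE /A /B in m3 mn m0 n3 db dg mAnB *.
  apply: rank_two_strings => //; [clear -db | clear -dg]; lia.
have two0 : 2%:R != 0 :> F by rewrite ((pcharf0P F).1 charF).
have : N ^+ 2 == p.+1%:R ^+ 2.
  rewrite -(inj_eq (mulIf two0)) NK KE intrM mulrC; apply/eqP; congr (_ * _).
  by rewrite rmorphXn.
have {q_gt0 pq3} p3 : (p <= 2)%N by clear -q_gt0 pq3; lia.
rewrite NE eqf_sqr => /orP[] /eqP ->; [exists p.+1%:Z | exists (- p.+1%:Z)].
  by split=> //; clear -p3; lia.
by rewrite intrN; split=> //; clear -p3; lia.
Qed.

(** * Nilpotency, coordinates and height *)

(** Cartan integers with respect to [beta] would differ by 8, but off the line of
    [beta] they lie between -3 and 3. *)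
Lemma weight_shift4 beta lam : beta \in rts -> lam \in 0 :: rts ->
  lam + beta *~ 4 \notin 0 :: rts.
Proof.
move=> br; rewrite inE => /orP[/eqP ->|lr].
  by rewrite add0r; apply/negP => /(root_multiple br) [].
have [->|lb] := eqVneq lam beta.
  by rewrite -[X in X + _]mulr1z -mulrzDr; apply/negP => /(root_multiple br) [].
have [->|lNb] := eqVneq lam (- beta).
  by rewrite -mulrN1z -mulrzDr; apply/negP => /(root_multiple br) [].
have ib : indep lam beta by rewrite /indep lb.
rewrite inE negb_or indep_line_neq0 //=; apply/negP => lbr.
have [c1 _ _] := cart_bounds br lr ib.
have [] := cart_bounds br lbr (indep_line 4 lr br ib).
by rewrite cart_shift // cart_self // => c2 _ _; clear -c1 c2; lia.
Qed.

Lemma iter_lie_X_mem (k : nat) beta lam x : beta \in rts -> x \in root_space lam ->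
  iter k (lie (X beta)) x \in root_space (lam + beta *~ k).
Proof.
move=> br xl; elim: k => [|k IHk] /=; first by rewrite mulr0z addr0.
by rewrite intS mulrzDr mulr1z addrCA lie_root_space ?X_mem.
Qed.

Lemma ad_X_pow4 beta x : beta \in rts -> iter 4 (lie (X beta)) x = 0.
Proof.
move=> br; have weight0 alpha y : alpha \in 0 :: rts -> y \in root_space alpha ->
    iter 4 (lie (X beta)) y = 0.
  move=> ar ya; apply: root_space_notin (weight_shift4 br ar) _.
  exact: iter_lie_X_mem 4 _ _ _ br ya.
rewrite (pi_sum x) /= !linearD /= !linear_sum /=.
rewrite [X in X + _](weight0 0 (pi 0 x)) ?mem_head // add0r big_seq big1 // => alpha ar.
by apply: (weight0 alpha); rewrite // inE ar orbT.
Qed.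

Definition coefX alpha x : F^o := coord [tuple X alpha] ord0 (pi alpha x).

Lemma coefX_linear alpha : linear (coefX alpha).
Proof. by move=> a x y; rewrite /coefX !linearP. Qed.

HB.instance Definition _ alpha :=
  GRing.isLinear.Build F g F^o _ (coefX alpha) (coefX_linear alpha).

Lemma pi_coefX alpha x : alpha \in rts -> pi alpha x = (coefX alpha x : F) *: X alpha.
Proof.
move=> ar; have [c cE] := root_space_line ar (pi_mem alpha x).
have := seq1_free (X alpha); rewrite X_neq0 // => X_free.
have := @coord_free _ _ _ [tuple X alpha] ord0 ord0 X_free; rewrite eqxx => XX.
by rewrite /coefX cE linearZ /= [coord _ _ _]XX mulr1.
Qed.

Lemma coefX_weight alpha lam x : alpha != lam -> x \in root_space lam -> coefX alpha x = 0.
Proof. by move=> al xl; rewrite /coefX (pi_root _ xl) (negPf al) linear0. Qed.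

Lemma coefX_self alpha x : x \in root_space alpha -> alpha \in rts ->
  x = (coefX alpha x : F) *: X alpha.
Proof. by move=> xa ar; rewrite -pi_coefX // (pi_root _ xa) eqxx. Qed.

Lemma coefX_X alpha beta : alpha \in rts -> beta \in rts ->
  coefX alpha (X beta) = (alpha == beta)%:R.
Proof.
move=> ar br; have [->|ab] := eqVneq alpha beta; last exact: coefX_weight ab (X_mem br).
have := coefX_self (X_mem br) br; rewrite -[X in X = _]scale1r => /eqP.
by rewrite -subr_eq0 -scalerBl scaler_eq0 (negPf (X_neq0 br)) orbF subr_eq0 => /eqP.
Qed.

Lemma root_decomposition x : x = pi 0 x + \sum_(alpha <- rts) (coefX alpha x : F) *: X alpha.
Proof.
rewrite {1}(pi_sum x); congr (_ + _); rewrite big_seq [RHS]big_seq.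
by apply: eq_bigr => alpha; apply: pi_coefX.
Qed.

Lemma poly_nonroot (p : {poly int}) : p != 0 -> exists n : int, p.[n] != 0.
Proof.
move=> p0; pose rs := [seq n%:Z | n <- iota 0 (size p)].
have [p_rs|/allPn[n _ pn]] := boolP (all (root p) rs); last by exists n.
have rs_uniq : uniq rs by rewrite map_inj_uniq ?iota_uniq // => m n [].
by have := max_poly_roots p0 p_rs rs_uniq; rewrite size_map size_iota ltnn.
Qed.

(** A root is not zero on its own coroot, so the polynomial whose coefficients
    are its Cartan integers is not zero.  A point where none of these finitely
    many polynomials vanishes gives an additive function that vanishes at no root,
    whose sign defines the positive roots. *)
Lemma exists_height : exists ht : dual h -> int,
  [/\ {in rts &, forall alpha beta, alpha + beta \in rts -> ht (alpha + beta) = ht alpha + ht beta},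
      {in rts, forall alpha, ht (- alpha) = - ht alpha}
    & {in rts, forall alpha, ht alpha != 0}].
Proof.
pose P alpha : {poly int} := \poly_(k < size rts) cart alpha (nth 0 rts k).
have P0 alpha : alpha \in rts -> P alpha != 0.
  move=> ar; apply/eqP => /(congr1 (fun p : {poly int} => p`_(index alpha rts))).
  by rewrite coef0 coef_poly index_mem ar nth_index // cart_self.
have [n] : exists n : int, (\prod_(alpha <- rts) P alpha).[n] != 0.
  by apply: poly_nonroot; rewrite prodf_seq_neq0; apply/allP => alpha /P0.
rewrite horner_prod prodf_seq_neq0 => /allP /= Pn.
exists (fun alpha => (P alpha).[n]); split=> // [alpha beta ar br abr|alpha ar].
  rewrite -hornerD; congr (_.[n]); apply/polyP => k; rewrite coefD !coef_poly.
  case: ifP => // kr; rewrite -[beta in LHS]mulr1z cart_shift ?mul1r ?mulr1z //.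
  exact: mem_nth.
rewrite -hornerN; congr (_.[n]); apply/polyP => k; rewrite coefN !coef_poly.
by case: ifP => // kr; rewrite cartNl // mem_nth.
Qed.

(** * The Chevalley order *)

Variable hZ : subvs_of h -> Prop.
Hypothesis hZ_lattice : is_lattice hZ.
Hypothesis hZ_lower : forall t, coroot_lattice H t -> hZ t.
Hypothesis hZ_upper : forall t, hZ t ->
  exists p z : subvs_of h, [/\ coweight_lattice H p, in_center (vsval z) & t = p + z].

Local Notation gZ := (chevalley_order hZ X).

Lemma hZD t u : hZ t -> hZ u -> hZ (t + u).
Proof.
have [b [_ hZE]] := hZ_lattice; rewrite !hZE => tb ub; exact: combinationD.
Qed.

Lemma hZ0 : hZ 0.
Proof. by have [b [_ hZE]] := hZ_lattice; rewrite hZE; apply: combination0. Qed.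

Lemma hZMz t (n : int) : hZ t -> hZ (t *~ n).
Proof. by have [b [_ hZE]] := hZ_lattice; rewrite !hZE; apply: int_spanZ. Qed.

Lemma hZ_coroot alpha : alpha \in rts -> hZ (H alpha).
Proof. by move=> /rtsP ar; apply/hZ_lower/int_span_gen; exists alpha. Qed.

(** A central element of [h] is killed by every root. *)
Lemma hZ_root t alpha : hZ t -> alpha \in rts -> exists n : int, (alpha t : F) = n%:~R.
Proof.
move=> /hZ_upper [p [z [[_ p_int] z_center ->]]] ar.
have [n pE] := p_int alpha ((rtsP alpha).2 ar); exists n.
have := z_center (X alpha); rewrite lie_hX // => /eqP.
rewrite scaler_eq0 (negPf (X_neq0 ar)) orbF => /eqP az.
by rewrite linearD /= az addr0 pE.
Qed.

Lemma gZ_h t : hZ t -> gZ (vsval t).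
Proof.
move=> th; exists t, 0; split=> //; last by rewrite addr0.
exact: combination0.
Qed.

Lemma gZ_X alpha : alpha \in rts -> gZ (X alpha).
Proof.
move=> /rtsP ar; exists 0, (X alpha); split; first exact: hZ0.
  by apply: int_span_gen; exists alpha.
by rewrite linear0 add0r.
Qed.

Lemma gZ0 : gZ 0.
Proof. by rewrite -[0](linear0 (@vsval _ _ h)); apply/gZ_h/hZ0. Qed.

Lemma gZD x y : gZ x -> gZ y -> gZ (x + y).
Proof.
move=> [t [x' [th x'X ->]]] [u [y' [uh y'X ->]]]; exists (t + u), (x' + y').
by split; [apply: hZD | apply: combinationD | rewrite linearD /= addrACA].
Qed.

Lemma gZMz x (n : int) : gZ x -> gZ (x *~ n).
Proof.
move=> [t [x' [th x'X ->]]]; exists (t *~ n), (x' *~ n).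
by split; [apply: hZMz | apply: int_spanZ | rewrite mulrzDl raddfMz].
Qed.

Lemma gZZ x (n : int) : gZ x -> gZ ((n%:~R : F) *: x).
Proof. by rewrite scaler_int; apply: gZMz. Qed.

Lemma gZ_sum I (r : seq I) (P : pred I) (x : I -> g) :
  (forall k, P k -> gZ (x k)) -> gZ (\sum_(k <- r | P k) x k).
Proof. by move=> xZ; apply: big_ind => //; [apply: gZ0 | apply: gZD]. Qed.

Lemma gZ_ind (Q : g -> Prop) :
  (forall x y, Q x -> Q y -> Q (x + y)) -> (forall x (n : int), Q x -> Q (x *~ n)) ->
  (forall t, hZ t -> Q (vsval t)) -> (forall alpha, alpha \in rts -> Q (X alpha)) ->
  forall x, gZ x -> Q x.
Proof.
move=> QD QM Qh QX x [t [y [th [n [c [x' [x'X yE]]]] ->]]]; rewrite yE.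
apply: (QD _ _ (Qh t th)).
have Q0 : Q 0 by rewrite -[0](linear0 (@vsval _ _ h)); apply/Qh/hZ0.
apply: (big_ind Q) => // k _.
by have [alpha /rtsP ar ->] := x'X k; exact/QM/QX.
Qed.

Lemma lieMz x y (n : int) : lie (x *~ n) y = lie x y *~ n.
Proof. by rewrite -!scaler_int lieZl. Qed.

(** Closure under the bracket is where the integrality of the structure constants,
    of the coroots and of the roots on [hZ] come together. *)
Lemma gZ_lie x y : gZ x -> gZ y -> gZ (lie x y).
Proof.
have hX t alpha : hZ t -> alpha \in rts -> gZ (lie (vsval t) (X alpha)).
  move=> th ar; have [n tE] := hZ_root th ar.
  by rewrite lie_hX // tE; apply/gZZ/gZ_X.
move=> xZ; move: y; apply: (gZ_ind (Q := fun y => gZ (lie x y))) => [y z|y n|t th|alpha ar].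
- by rewrite linearD; apply: gZD.
- by rewrite raddfMz; apply: gZMz.
- move: x xZ; apply: (gZ_ind (Q := fun x => gZ (lie x (vsval t)))) => [y z|y n|u uh|alpha ar].
  + by rewrite lieDl; apply: gZD.
  + by rewrite lieMz; apply: gZMz.
  + by rewrite (cartan_abelian h_split) ?subvsP //; apply: gZ0.
  by rewrite lieC -mulrN1z; apply/gZMz/hX.
move: x xZ; apply: (gZ_ind (Q := fun x => gZ (lie x (X alpha)))) => [y z|y n|u uh|beta br].
- by rewrite lieDl; apply: gZD.
- by rewrite lieMz; apply: gZMz.
- exact: hX.
have [->|ba] := eqVneq beta alpha; first by rewrite liexx; apply: gZ0.
have [->|bNa] := eqVneq beta (- alpha).
  rewrite lieC lie_XXN // opprK; exact/gZ_h/hZ_coroot.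
have ab : indep alpha beta by rewrite indep_sym /indep ba.
have [bar|baN] := boolP (beta + alpha \in rts).
  by have [N [-> _ _]] := structure_constant br ar ab bar; apply/gZZ/gZ_X.
rewrite (lie_XX_nonroot (X_mem br) (X_mem ar)); first exact: gZ0.
by rewrite inE negb_or baN andbT addr_eq0.
Qed.

Lemma gZ_exp_ad x y : gZ x -> gZ y -> gZ (exp_ad x y).
Proof.
move=> xZ yZ; have Zn (n : nat) z : gZ z -> gZ ((n%:R : F) *: z).
  by rewrite pmulrn; apply: gZZ.
by rewrite /exp_ad; do ?[apply: gZD | apply: Zn | apply: gZ_lie].
Qed.

Lemma gZ_coefX x alpha : alpha \in rts -> gZ x -> exists n : int, coefX alpha x = n%:~R.
Proof.
move=> ar; move: x; apply: (gZ_ind (Q := fun x => exists n : int, coefX alpha x = n%:~R))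
  => [x y [m mE] [n nE]|x n [m mE]|t th|beta br].
- by exists (m + n); rewrite linearD /= mE nE intrD.
- by exists (m * n); rewrite raddfMz /= mE intrM mulrzr.
- exists 0; apply: (@coefX_weight alpha 0); first exact: rts_neq0.
  by rewrite (root_space0 h_split) subvsP.
by exists ((alpha == beta) : nat); rewrite coefX_X // -pmulrn.
Qed.

Definition hpart x : subvs_of h := vsproj h (pi 0 x).

Lemma hpartK x : vsval (hpart x) = pi 0 x.
Proof. by rewrite /hpart vsprojK // -(root_space0 h_split). Qed.

Lemma hpart_vsval t : hpart (vsval t) = t.
Proof.
apply: subvs_inj; rewrite hpartK (@pi_root 0 0) ?eqxx //.
by rewrite (root_space0 h_split) subvsP.
Qed.

Lemma hpart_X alpha : alpha \in rts -> hpart (X alpha) = 0.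
Proof.
move=> ar; apply: subvs_inj; rewrite hpartK (pi_root 0 (X_mem ar)) eq_sym.
by rewrite (negPf (rts_neq0 ar)) linear0.
Qed.

Lemma hpartD x y : hpart (x + y) = hpart x + hpart y.
Proof. by rewrite /hpart !linearD. Qed.

Lemma gZ_hpart x : gZ x -> hZ (hpart x).
Proof.
move: x; apply: (gZ_ind (Q := fun x => hZ (hpart x))) => [x y xh yh|x n xh|t th|alpha ar].
- by rewrite hpartD; apply: hZD.
- by rewrite /hpart !raddfMz; apply: hZMz.
- by rewrite hpart_vsval.
by rewrite hpart_X //; apply: hZ0.
Qed.

(** * Base change *)

Variables (R : comPzRingType) (gR : lieAlgType R) (i : g -> gR).
Hypothesis gR_base_change : is_base_change gZ i.
Hypothesis gR_lie : forall x y, gZ x -> gZ y -> lie (i x) (i y) = i (lie x y).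

Lemma iD x y : gZ x -> gZ y -> i (x + y) = i x + i y.
Proof. by have [iA _] := gR_base_change; apply: iA. Qed.

Lemma i0 : i 0 = 0.
Proof. by apply: (@addrI _ (i 0)); rewrite -iD ?addr0 //; apply: gZ0. Qed.

Lemma iN x : gZ x -> i (- x) = - i x.
Proof.
move=> xZ; apply/eqP; rewrite -addr_eq0 -iD ?addNr ?i0 //.
by rewrite -mulrN1z; apply: gZMz.
Qed.

Lemma iMz x (n : int) : gZ x -> i (x *~ n) = n%:~R *: i x.
Proof.
move=> xZ; have iMn k : i (x *+ k) = k%:R *: i x.
  elim: k => [|k IHk]; first by rewrite scale0r i0.
  have xkZ : gZ (x *+ k) by rewrite pmulrn; apply: gZMz.
  by rewrite mulrS iD // IHk -natr1 addrC scalerDl scale1r.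
case: n => k; first by rewrite -pmulrn iMn.
rewrite NegzE !mulrNz -!pmulrn iN ?iMn ?scaleNr //.
by rewrite -[x *+ _]/(x *~ k.+1); apply: gZMz.
Qed.

Lemma iZ x (n : int) : gZ x -> i ((n%:~R : F) *: x) = n%:~R *: i x.
Proof. by rewrite scaler_int; apply: iMz. Qed.

Lemma i_sum (I : eqType) (r : seq I) (x : I -> g) :
  (forall k, k \in r -> gZ (x k)) -> i (\sum_(k <- r) x k) = \sum_(k <- r) i (x k).
Proof.
elim: r => [|k r IHr] xZ; first by rewrite !big_nil i0.
rewrite !big_cons iD ?IHr // => [l lr||]; first by apply: xZ; rewrite inE lr orbT.
  by apply: xZ; rewrite mem_head.
by rewrite big_seq; apply: gZ_sum => l lr; apply: xZ; rewrite inE lr orbT.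
Qed.

Lemma base_change_ext (M : lmodType R) (u v : {linear gR -> M}) :
  (forall x, gZ x -> u (i x) = v (i x)) -> u =1 v.
Proof.
have [_ /(_ M (fun=> 0)) univ] := gR_base_change.
by have [|_] := univ; [move=> x y _ _; rewrite addr0 | apply].
Qed.

(** Coordinates on [gR] are the extensions to [R] of linear forms over [F] that are
    integral on [gZ]; such a form is first made integer valued by [int_val], as
    the universal property requires a map into an [R]-module. *)
Definition lift_form (f : g -> F) : {linear gR -> R^o} :=
  epsilon (inhabits (\0 : {linear gR -> R^o}))
    (fun u => forall x, gZ x -> u (i x) = (int_val (f x))%:~R).

Lemma lift_formE (f : g -> F) x (n : int) :
  {morph f : y z / y + z} -> (forall y, gZ y -> exists m : int, f y = m%:~R) ->
  gZ x -> f x = n%:~R -> lift_form f (i x) = n%:~R.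
Proof.
move=> fD fZ xZ fxn.
have [_ /(_ R^o (fun y => (int_val (f y))%:~R)) univ] := gR_base_change.
have [|u_ex _] := univ.
  move=> y z yZ zZ; have [[m mE] [k kE]] := (fZ y yZ, fZ z zZ).
  by rewrite fD mE kE -intrD !int_valK intrD.
by rewrite (epsilon_spec _ _ u_ex) // fxn int_valK.
Qed.

Definition cR alpha := lift_form (coefX alpha).
Definition chiR alpha := lift_form (fun x => alpha (hpart x)).
Definition xR alpha := i (X alpha).
Definition tR (t : subvs_of h) := i (vsval t).

Lemma cRE alpha x (n : int) : alpha \in rts -> gZ x -> coefX alpha x = n%:~R ->
  cR alpha (i x) = n%:~R.
Proof.
move=> ar; apply: lift_formE => [y z|y]; first by rewrite linearD.
exact: gZ_coefX.
Qed.

Lemma cR_xR alpha beta : alpha \in rts -> beta \in rts ->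
  cR alpha (xR beta) = (alpha == beta)%:R.
Proof.
move=> ar br; rewrite (@cRE _ _ (Posz (alpha == beta))) ?coefX_X -?pmulrn //.
exact: gZ_X.
Qed.

Lemma coefX_h alpha (t : subvs_of h) : alpha \in rts -> coefX alpha (vsval t) = 0.
Proof.
move=> ar; apply: (@coefX_weight alpha 0); first exact: rts_neq0.
by rewrite (root_space0 h_split) subvsP.
Qed.

Lemma cR_tR alpha t : alpha \in rts -> hZ t -> cR alpha (tR t) = 0.
Proof. by move=> ar th; rewrite (@cRE _ _ 0) ?coefX_h //; apply: gZ_h. Qed.

Lemma lie_tR_xR t (n : int) alpha : hZ t -> alpha \in rts -> (alpha t : F) = n%:~R ->
  lie (tR t) (xR alpha) = n%:~R *: xR alpha.
Proof.
move=> th ar tn; rewrite /tR /xR gR_lie ?lie_hX ?tn ?iZ //; try exact: gZ_X.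
exact: gZ_h.
Qed.

Lemma lie_tR_tR t u : hZ t -> hZ u -> lie (tR t) (tR u) = 0.
Proof.
move=> th uh; rewrite /tR gR_lie ?(cartan_abelian h_split) ?i0 ?subvsP //; exact: gZ_h.
Qed.

Lemma lie_xR_xRN alpha : alpha \in rts -> lie (xR alpha) (xR (- alpha)) = - tR (H alpha).
Proof.
move=> ar; rewrite /xR /tR gR_lie ?lie_XXN ?iN //; try exact/gZ_X/rtsN.
  exact/gZ_h/hZ_coroot.
exact: gZ_X.
Qed.

(** The projection onto the torus along the root vectors. *)
Definition hR v : gR := v - \sum_(alpha <- rts) (cR alpha v : R) *: xR alpha.

Lemma hR_linear : linear hR.
Proof.
move=> a v w; rewrite /hR scalerBr scaler_sumr addrACA -opprD -big_split /=; congr (_ - _).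
apply: eq_bigr => alpha _; rewrite linearP scalerDl.
by rewrite -[X in (X *: _) + _]/(a * _) scalerA.
Qed.

HB.instance Definition _ := GRing.isLinear.Build R gR gR _ hR hR_linear.

Lemma hR_split v : v = hR v + \sum_(alpha <- rts) (cR alpha v : R) *: xR alpha.
Proof. by rewrite /hR subrK. Qed.

Lemma hR_i x : gZ x -> hR (i x) = tR (hpart x).
Proof.
move=> xZ; rewrite /hR /tR hpartK.
have pE : pi 0 x = x - \sum_(alpha <- rts) (coefX alpha x : F) *: X alpha.
  by rewrite {1}[x in RHS]root_decomposition addrK.
have cZ alpha : alpha \in rts -> gZ ((coefX alpha x : F) *: X alpha).
  by move=> ar; have [n ->] := gZ_coefX ar xZ; apply/gZZ/gZ_X.
have sZ : gZ (\sum_(alpha <- rts) (coefX alpha x : F) *: X alpha).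
  by rewrite big_seq; apply: gZ_sum.
rewrite pE iD // ?iN // ?i_sum //; last by rewrite -mulrN1z; apply: gZMz.
congr (_ - _); rewrite big_seq [RHS]big_seq; apply: eq_bigr => alpha ar.
have [n nE] := gZ_coefX ar xZ; rewrite (cRE ar xZ nE) nE iZ //; exact: gZ_X.
Qed.

Lemma lie_hR_hR v w : lie (hR v) (hR w) = 0.
Proof.
pose f2 w : {linear gR -> gR} := (lie (hR w)) \o hR.
have ext w' : forall x, gZ x -> lie (hR w') (hR (i x)) = 0.
  move=> x xZ; rewrite lieC -[lie _ _]/(f2 (i x) w').
  rewrite (@base_change_ext _ (f2 (i x)) \0) ?oppr0 // => y yZ.
  by rewrite /= !hR_i // lie_tR_tR //; apply: gZ_hpart.
by have := @base_change_ext _ (f2 v) \0 (ext v) w.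
Qed.

Lemma lie_hR_xR v alpha : alpha \in rts ->
  lie (hR v) (xR alpha) = (chiR alpha v : R) *: xR alpha.
Proof.
move=> ar; apply/eqP; rewrite -subr_eq0.
pose f v := lie (hR v) (xR alpha) - (chiR alpha v : R) *: xR alpha.
have f_lin : linear f.
  move=> a y z; rewrite /f.
  have -> : (chiR alpha (a *: y + z) : R) = a * chiR alpha y + chiR alpha z by rewrite linearP.
  by rewrite linearP /= lieDl lieZl; linear_combination R.
pose fL := GRing.isLinear.Build R gR gR _ f f_lin.
pose u : {linear gR -> gR} := HB.pack f fL.
apply/eqP; apply: (@base_change_ext _ u \0 _ v) => x xZ; rewrite /= /f hR_i //.
have xh := gZ_hpart xZ; have [n nE] := hZ_root xh ar.
rewrite (lie_tR_xR xh ar nE) (@lift_formE _ _ n) ?subrr // => [y z|y yZ].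
  by rewrite hpartD linearD.
by apply: hZ_root => //; apply: gZ_hpart.
Qed.

(** A lattice basis of [h] and the root vectors span [gR], with coordinate forms;
    this is the input of [exterior_spanned]. *)
Lemma finitely_spanned : exists n (E : 'I_n -> gR) (c : 'I_n -> {linear gR -> R^o}),
  forall v, v = \sum_k (c k v : R) *: E k.
Proof.
have [b [b_basis hZE]] := hZ_lattice; pose r := size b; pose m := size rts.
pose bt : r.-tuple (subvs_of h) := in_tuple b.
have bt_basis : basis_of fullv bt := b_basis.
have coordZ t k : hZ t -> exists n : int, coord bt k t = n%:~R.
  rewrite hZE => -[n [c [x [xb ->]]]].
  exists (\sum_j c j * (k == index (x j) b :> nat)%:R); rewrite linear_sum /= rmorph_sum /=.
  apply: eq_bigr => j _; rewrite raddfMz /= intrM -mulrzl; congr (_ * _).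
  have jb : (index (x j) b < r)%N by rewrite index_mem; apply: xb.
  rewrite -{1}(nth_index 0 (xb j)) (@coord_free _ _ _ bt (Ordinal jb)) //; last first.
    exact: basis_free b_basis.
  by rewrite -val_eqE /= eq_sym rmorph_nat.
pose cf (k : 'I_r) := lift_form (fun x => coord bt k (hpart x)).
have cfE k t : hZ t -> (cf k (tR t) : R) *: tR b`_k = i ((coord bt k t : F) *: vsval b`_k).
  move=> th; have [n nE] := coordZ t k th.
  have bk : hZ b`_k by rewrite hZE; apply: int_span_gen; rewrite mem_nth.
  rewrite (@lift_formE _ _ n) ?nE ?iZ ?hpart_vsval //; try exact: gZ_h.
    by move=> y z; rewrite hpartD linearD.
  by move=> y yZ; apply/coordZ/gZ_hpart.
pose E (k : 'I_(r + m)) := match split k with inl j => tR b`_j | inr a => xR rts`_a end.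
pose c (k : 'I_(r + m)) := match split k with inl j => cf j | inr a => cR rts`_a end.
exists (r + m)%N, E, c => v.
have splitE : \sum_k (c k v : R) *: E k
    = \sum_(j < r) (cf j v : R) *: tR b`_j + \sum_(alpha <- rts) (cR alpha v : R) *: xR alpha.
  rewrite big_split_ord /=; congr (_ + _); last rewrite (big_nth 0) big_mkord;
    apply: eq_bigr => k _; rewrite /c /E.
    by rewrite -[lshift m k]/(unsplit (inl k)) unsplitK.
  by rewrite -[rshift r k]/(unsplit (inr k)) unsplitK.
rewrite splitE {1}(hR_split v); congr (_ + _) => {splitE}.
pose f v := \sum_(j < r) (cf j v : R) *: tR b`_j.
have f_lin : linear f.
  move=> a y z; rewrite /f scaler_sumr -big_split; apply: eq_bigr => j _.
  by rewrite linearP scalerDl -[X in (X *: _) + _]/(a * _) scalerA.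
pose fL := GRing.isLinear.Build R gR gR _ f f_lin.
pose u : {linear gR -> gR} := HB.pack f fL.
apply: (@base_change_ext _ hR u) => x xZ /=; rewrite hR_i //.
have xh := gZ_hpart xZ; set t := hpart x in xh *.
have cf_x j : cf j (i x) = cf j (tR t).
  have [n nE] := coordZ t j xh.
  have cfD : {morph (fun x => coord bt j (hpart x)) : y z / y + z}.
    by move=> y z; rewrite hpartD linearD.
  have cfZ y : gZ y -> exists n : int, coord bt j (hpart y) = n%:~R.
    by move=> yZ; apply/coordZ/gZ_hpart.
  rewrite (@lift_formE _ _ n) // (@lift_formE _ _ n) //; first exact: gZ_h.
  by rewrite hpart_vsval.
rewrite /f; under eq_bigr => j _ do rewrite cf_x cfE //.
rewrite -i_sum => [|j _].
  rewrite /tR; congr i; rewrite {1}(coord_basis bt_basis (memvf t)) linear_sum.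
  by apply: eq_bigr => j _; rewrite linearZ.
have [n ->] := coordZ t j xh; apply/gZZ/gZ_h; rewrite hZE; apply: int_span_gen.
by rewrite mem_nth.
Qed.

(** * Commuting pairs with a prescribed weight zero part *)

Lemma indep_linear gamma beta (k l : int) :
  gamma \in rts -> beta \in rts -> indep gamma beta ->
  gamma *~ k + beta *~ l = 0 -> k = 0 /\ l = 0.
Proof.
move=> gr br gb E.
have lin alpha : alpha \in rts -> k * cart gamma alpha + l * cart beta alpha = 0.
  move=> ar; apply: intrF_inj; rewrite intrD !intrM -!cartE //.
  have := congr1 (fun lam : dual h => (lam (H alpha) : F)) E.
  by rewrite /= lfunE /= !mulrz_dual !scale_lfunE lfunE.
have := lin _ gr; have := lin _ br; rewrite !cart_self // => E1 E2.
have [_ mn _] := cart_bounds br gr gb.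
move: mn E1 E2; set m := cart gamma beta; set n := cart beta gamma => mn E1 E2.
have l0 : l * (4 - n * m) = 0.
  have -> : l * (4 - n * m) = 2 * (k * m + l * 2) - m * (k * 2 + l * n) by ring.
  by rewrite E1 E2; ring.
have {}l0 : l = 0.
  by move/eqP: l0; rewrite mulf_eq0 => /orP[/eqP //|/eqP]; clear -mn; lia.
by split=> //; move: E2; rewrite l0; clear; lia.
Qed.

Lemma exp_adD e x y : exp_ad e (x + y) = exp_ad e x + exp_ad e y.
Proof. by rewrite /exp_ad !linearD /=; linear_combination F. Qed.

Lemma exp_adZ e (a : F) x : exp_ad e (a *: x) = a *: exp_ad e x.
Proof. by rewrite /exp_ad !linearZ /=; linear_combination F. Qed.

Lemma coefXD alpha x y : (coefX alpha (x + y) : F) = (coefX alpha x : F) + coefX alpha y.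
Proof. exact: linearD. Qed.

Lemma coefXN alpha x : (coefX alpha (- x) : F) = - (coefX alpha x : F).
Proof. exact: linearN. Qed.

Lemma coefXZ alpha (a : F) x : (coefX alpha (a *: x) : F) = a * (coefX alpha x : F).
Proof. exact: linearZ. Qed.

Lemma coefX_exp_ad alpha beta lam x : beta \in rts -> x \in root_space lam ->
  (forall j : nat, (0 < j <= 3)%N -> alpha != lam + beta *~ j) ->
  coefX alpha (exp_ad (X beta) x) = 6%:R * (coefX alpha x : F).
Proof.
move=> br xl neq; rewrite /exp_ad !(coefXD, coefXZ).
have c0 j : (0 < j <= 3)%N -> coefX alpha (iter j (lie (X beta)) x) = 0.
  by move=> jP; apply: coefX_weight (neq j jP) (iter_lie_X_mem j br xl).
rewrite -[lie (X beta) x]/(iter 1 (lie (X beta)) x) c0 //.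
rewrite -[lie (X beta) (iter 1 _ x)]/(iter 2 (lie (X beta)) x) c0 //.
rewrite -[lie (X beta) (iter 2 _ x)]/(iter 3 (lie (X beta)) x) c0 //.
by rewrite !mulr0 !addr0.
Qed.

Lemma coefX_exp_ad0 alpha beta lam x : beta \in rts -> x \in root_space lam ->
  (forall j : nat, (j <= 3)%N -> alpha != lam + beta *~ j) ->
  coefX alpha (exp_ad (X beta) x) = 0.
Proof.
move=> br xl neq; rewrite (coefX_exp_ad br xl) => [|j /andP[_ /neq] //].
rewrite (coefX_weight _ xl) ?mulr0 //.
by have := neq 0%N isT; rewrite mulr0z addr0.
Qed.

(** For a triangle of roots [beta], [gamma] and [delta = beta + gamma], the pair
    [(tri_x, tri_y)] is the conjugate of [(tri_t, X (- delta))] by two truncated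
    exponentials, where [tri_t] is killed by [delta] and has a small nonzero value
    [tri_k] at [gamma].  The only products of a coordinate of [tri_x] at a root
    and of [tri_y] at the opposite root that are not zero occur at [beta],
    [gamma] and [delta], and the one at [delta] is explicit. *)
Section Triangle.
Variables beta gamma : dual h.
Hypotheses (br : beta \in rts) (gr : gamma \in rts) (gb : indep gamma beta).
Local Notation delta := (beta + gamma).
Hypothesis dr : delta \in rts.

Lemma triangle_neq (k l : int) alpha : (k != 0) || (l != 0) ->
  alpha != alpha + (gamma *~ k + beta *~ l).
Proof.
move=> kl; apply/eqP => /eqP; rewrite -{1}[alpha]addr0 (inj_eq (addrI alpha)) eq_sym.
by move=> /eqP /(indep_linear gr br gb) [k0 l0]; move: kl; rewrite k0 l0.
Qed.

Definition tri_t : subvs_of h :=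
  (2%:R : F) *: H gamma - ((cart delta gamma)%:~R : F) *: H delta.

Definition tri_k : int := 4 - cart delta gamma * cart gamma delta.

Definition tri_x := exp_ad (X beta) (exp_ad (X gamma) (vsval tri_t)).
Definition tri_y := exp_ad (X beta) (exp_ad (X gamma) (X (- delta))).

Lemma tri_t_hZ : hZ tri_t.
Proof.
rewrite /tri_t -scaleNr; apply: hZD; first by rewrite scaler_nat pmulrn; apply/hZMz/hZ_coroot.
by rewrite -intrN scaler_int; apply/hZMz/hZ_coroot.
Qed.

Lemma tri_tE alpha : (alpha tri_t : F) =
  2%:R * (alpha (H gamma) : F) - (cart delta gamma)%:~R * (alpha (H delta) : F).
Proof. by rewrite /tri_t linearB !linearZ. Qed.

Lemma tri_delta : (delta tri_t : F) = 0.
Proof. by rewrite tri_tE [delta (H delta)]coroot_root // cartE // mulrC subrr. Qed.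

Lemma tri_gamma : (gamma tri_t : F) = tri_k%:~R.
Proof.
by rewrite tri_tE coroot_root // cartE // /tri_k intrB intrM -natrM.
Qed.

Lemma tri_beta : (beta tri_t : F) = - tri_k%:~R.
Proof.
have := tri_delta; rewrite add_lfunE tri_gamma => /eqP.
by rewrite addr_eq0 => /eqP.
Qed.

Lemma tri_k_bounds : 1 <= tri_k <= 4.
Proof.
have dg : indep delta gamma.
  by have := indep_line 1 br gr; rewrite mulr1z indep_sym => /(_ gb).
have [_ + _] := cart_bounds gr dr dg; rewrite /tri_k mulrC; clear; lia.
Qed.

Lemma tri_gZ : gZ tri_x /\ gZ tri_y.
Proof.
split; apply: (gZ_exp_ad (gZ_X br)); apply: (gZ_exp_ad (gZ_X gr)).
  exact/gZ_h/tri_t_hZ.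
exact/gZ_X/rtsN.
Qed.

Lemma tri_commute : lie tri_x tri_y = 0.
Proof.
apply: exp_ad_commute => //; rewrite ?ad_X_pow4 //.
apply: exp_ad_commute => //; rewrite ?ad_X_pow4 //.
by rewrite lie_hX ?rtsN // opp_lfunE tri_delta oppr0 scale0r.
Qed.

Lemma tri_xE : tri_x = (36%:R : F) *: vsval tri_t + (36%:R * tri_k%:~R : F) *: X beta
  - (6%:R * tri_k%:~R : F) *: exp_ad (X beta) (X gamma).
Proof.
have ht alpha : alpha \in rts -> lie (X alpha) (vsval tri_t) = - (alpha tri_t : F) *: X alpha.
  by move=> ar; rewrite lieC lie_hX // scaleNr.
have x1E : exp_ad (X gamma) (vsval tri_t)
    = (6%:R : F) *: vsval tri_t - (6%:R * tri_k%:~R : F) *: X gamma.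
  rewrite /exp_ad ht // tri_gamma !linearZ /= liexx linear0 !linear0.
  linear_combination F.
rewrite /tri_x x1E exp_adD -scaleNr !exp_adZ; congr (_ + _); last by rewrite scaleNr.
rewrite /exp_ad ht // tri_beta !linearZ /= liexx !linear0.
linear_combination F.
Qed.

Lemma tri_x_coef alpha : alpha \in rts -> coefX alpha tri_x =
  36%:R * tri_k%:~R * (coefX alpha (X beta) : F)
  - 6%:R * tri_k%:~R * (coefX alpha (exp_ad (X beta) (X gamma)) : F).
Proof.
move=> ar; rewrite tri_xE; have := coefX_h tri_t ar.
move: (vsval tri_t) (exp_ad _ _) => t e t0.
by rewrite !(coefXD, coefXN, coefXZ) t0 mulr0 add0r.
Qed.

(** Only the first order term of the second exponential, applied to [X gamma],
    has weight [delta]. *)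
Lemma tri_x_delta (N : int) : lie (X beta) (X gamma) = (N%:~R : F) *: X delta ->
  coefX delta tri_x = (- (36 * tri_k * N))%:~R.
Proof.
move=> NE; have db : delta != beta.
  have := triangle_neq beta (isT : (1 != 0 :> int) || (0 != 0 :> int)).
  by rewrite mulr0z mulr1z addr0 eq_sym.
have dg : delta != gamma.
  have := triangle_neq gamma (isT : (0 != 0 :> int) || (1 != 0 :> int)).
  by rewrite mulr0z mulr1z add0r addrC eq_sym.
have dgk (k : nat) : (1 < k)%N -> delta != gamma + beta *~ k.
  move=> k1; have -> : gamma + beta *~ k = delta + (gamma *~ 0 + beta *~ (k%:Z - 1)).
    by rewrite !mulrz_dual intrB; linear_combination F.
  by apply: triangle_neq; clear -k1; lia.
rewrite tri_x_coef // (coefX_X dr br) (negPf db).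
rewrite !mulr0 add0r /exp_ad !(coefXD, coefXN, coefXZ) (coefX_X dr gr) (negPf dg).
rewrite [coefX delta (lie (X beta) (lie (X beta) (X gamma)))](@coefX_weight _ (gamma + beta *~ 2)).
- rewrite [coefX delta (lie _ (lie _ _))](@coefX_weight _ (gamma + beta *~ 3)).
  + rewrite NE coefXZ (coefX_X dr dr) eqxx.
    rewrite !mulr0 mulr1 add0r !addr0 mulrACA -natrM mulrA.
    by rewrite intrN !intrM -pmulrn.
  + exact: dgk.
  exact: iter_lie_X_mem 3 _ _ _ br (X_mem gr).
- exact: dgk.
exact: iter_lie_X_mem 2 _ _ _ br (X_mem gr).
Qed.

Lemma tri_y_coef alpha : (forall k j : nat, (k <= 3)%N -> (j <= 3)%N -> (0 < k + j)%N ->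
    alpha != - delta + gamma *~ k + beta *~ j) ->
  coefX alpha tri_y = 36%:R * (coefX alpha (X (- delta)) : F).
Proof.
move=> neq; pose v k := iter k (lie (X gamma)) (X (- delta)).
have vmem k : v k \in root_space (- delta + gamma *~ k).
  by apply: iter_lie_X_mem => //; apply/X_mem/rtsN.
have v0 k : (0 < k <= 3)%N -> coefX alpha (exp_ad (X beta) (v k)) = 0.
  move=> /andP[k0 k3]; apply: coefX_exp_ad0 (vmem k) _ => // j j3.
  by apply: neq => //; rewrite addn_gt0 k0.
have c0 : coefX alpha (exp_ad (X beta) (v 0%N)) = 6%:R * (coefX alpha (X (- delta)) : F).
  by apply: (coefX_exp_ad br (vmem 0%N)) => j /andP[j0 j3]; apply: neq.
rewrite /tri_y [exp_ad (X gamma) _]/exp_ad !exp_adD !exp_adZ.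
move: c0 (v0 1%N isT) (v0 2%N isT) (v0 3%N isT); rewrite /v /=.
move: (exp_ad _ _) (exp_ad _ _) (exp_ad _ _) (exp_ad _ _) => e0 e1 e2 e3 c0 c1 c2 c3.
by rewrite !(coefXD, coefXZ) c0 c1 c2 c3 !mulr0 !addr0 mulrA -natrM.
Qed.

(** Raising [X (- delta)] by [gamma] or [beta] moves it away from [- delta], so only
    the two factors 6 remain. *)
Lemma tri_y_delta : coefX (- delta) tri_y = 36%:R.
Proof.
rewrite tri_y_coef ?coefX_X ?rtsN // ?eqxx ?mulr1 // => k j _ _ kj.
rewrite -addrA; apply: triangle_neq; clear -kj; lia.
Qed.

(** The roots of [tri_x] are [beta] and those of the form [gamma + k beta].  For
    [k > 1] the opposite of the latter is not obtained from [- delta] by adding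
    nonnegative multiples of [gamma] and [beta]. *)
Lemma tri_support alpha : alpha \in rts -> alpha != beta -> alpha != gamma -> alpha != delta ->
  coefX alpha tri_x = 0 \/ coefX (- alpha) tri_y = 0.
Proof.
move=> ar ab ag ad.
have [/hasP[k]|/hasPn neq] := boolP (has (fun k : nat => alpha == gamma + beta *~ k) (iota 2 2)).
  rewrite mem_iota => /andP[k2 _] /eqP aE; right.
  rewrite tri_y_coef => [|l j _ _ lj].
    rewrite coefX_X ?rtsN // eqr_opp (negPf ad) mulr0 //.
  have -> : - delta + gamma *~ l + beta *~ j
      = - alpha + (gamma *~ l + beta *~ (j%:Z + k%:Z - 1)).
    rewrite aE !mulrz_dual intrB intrD; linear_combination F.
  apply: triangle_neq; clear -lj k2; lia.
left; rewrite tri_x_coef // (coefX_X ar br) (negPf ab).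
rewrite (@coefX_exp_ad0 _ _ gamma) ?X_mem ?mulr0 ?addr0 ?subr0 //.
case=> [|[|j]] jl; rewrite ?mulr0z ?addr0 ?mulr1z //; first by rewrite addrC.
by apply: neq; rewrite mem_iota; clear -jl; lia.
Qed.

End Triangle.

(** * Wedges modulo commuting wedges *)

Variables (u2 u3 : R).
Hypotheses (u2E : 2%:R * u2 = 1) (u3E : 3%:R * u3 = 1).
Variables (W : lmodType R) (wedge : gR -> gR -> W).
Hypothesis W_exterior : is_exterior_square wedge.

Let wedge_alt : is_alternating wedge := proj1 W_exterior.

Local Notation comm_span := (lin_span (commuting_wedge wedge)).

Lemma small_unit (n : int) : n != 0 -> -4 <= n <= 4 -> exists u : R, u * n%:~R = 1.
Proof.
move=> n0 n4; suff [u uE] : exists u : R, u * `|n|%N%:R = 1.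
  have [n_ge0|n_lt0] := leP 0 n.
    by exists u; rewrite -[n]gez0_abs // -pmulrn.
  have nE : n = - `|n|%N%:Z by rewrite lez0_abs ?opprK // ltW.
  by exists (- u); rewrite nE intrN mulrNN -pmulrn.
have : (0 < `|n| <= 4)%N by clear -n0 n4; lia.
case: `|n|%N => [|[|[|[|[|m]]]]] // _.
- by exists 1; rewrite mulr1.
- by exists u2; rewrite mulrC.
- by exists u3; rewrite mulrC.
by exists (u2 * u2); rewrite (natrM _ 2 2) mulrACA ![u2 * _]mulrC u2E mulr1.
Qed.

Lemma commD v w : comm_span v -> comm_span w -> comm_span (v + w).
Proof. exact: combinationD. Qed.

Lemma commZ a v : comm_span v -> comm_span (a *: v).
Proof. exact: lin_spanZ. Qed.

Lemma comm0 : comm_span 0.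
Proof. exact: combination0. Qed.

Lemma commB v w : comm_span v -> comm_span w -> comm_span (v - w).
Proof. by move=> Nv Nw; apply: commD => //; rewrite -scaleN1r; apply: commZ. Qed.

Lemma comm_unit (a : R) v : (exists u, u * a = 1) -> comm_span (a *: v) -> comm_span v.
Proof. by move=> [u uE] /(commZ u); rewrite scalerA uE scale1r. Qed.

(** A section of the bracket on the part of nonzero weight: the bracket of
    [H alpha] and [x alpha] is [2 x alpha]. *)
Definition sigmaR v : W :=
  \sum_(alpha <- rts) ((cR alpha v : R) * u2) *: wedge (tR (H alpha)) (xR alpha).

Lemma sigmaRD v w : sigmaR (v + w) = sigmaR v + sigmaR w.
Proof.
rewrite /sigmaR -big_split; apply: eq_bigr => alpha _.
by rewrite linearD /= mulrDl scalerDl.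
Qed.

Lemma sigmaRZ a v : sigmaR (a *: v) = a *: sigmaR v.
Proof.
rewrite /sigmaR scaler_sumr; apply: eq_bigr => alpha _.
by rewrite linearZ /= scalerA mulrA.
Qed.

Lemma sigmaR0 : sigmaR 0 = 0.
Proof. by rewrite -[X in sigmaR X](scale0r 0) sigmaRZ scale0r. Qed.

Lemma sigmaR_xR alpha : alpha \in rts ->
  sigmaR (xR alpha) = u2 *: wedge (tR (H alpha)) (xR alpha).
Proof.
move=> ar; rewrite /sigmaR (bigD1_seq alpha) //= cR_xR // eqxx mul1r.
rewrite big_seq_cond big1 ?addr0 // => beta /andP[br ba].
by rewrite cR_xR // (negPf ba) mul0r scale0r.
Qed.

Lemma sigmaR_tR t : hZ t -> sigmaR (tR t) = 0.
Proof.
move=> th; rewrite /sigmaR big_seq big1 // => alpha ar.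
by rewrite cR_tR // mul0r scale0r.
Qed.

Definition zR alpha : W := wedge (xR alpha) (xR (- alpha)).

(** The weight zero part of the wedge of [v] and [w], apart from the torus. *)
Definition zform v w : W :=
  \sum_(alpha <- rts) ((cR alpha v : R) * cR (- alpha) w) *: zR alpha.

Lemma zR_opp alpha : zR (- alpha) = - zR alpha.
Proof. by rewrite /zR opprK (wedgeC wedge_alt). Qed.

Definition split_wedge v w := comm_span (wedge v w - sigmaR (lie v w) - zform v w).

Lemma split_wedgeDl v v' w : split_wedge v w -> split_wedge v' w -> split_wedge (v + v') w.
Proof.
rewrite /split_wedge => Nv Nv'; have := commD Nv Nv'; congr comm_span.
rewrite lieDl sigmaRD (wedgeDl wedge_alt).
have -> : zform (v + v') w = zform v w + zform v' w.
  rewrite /zform -big_split; apply: eq_bigr => alpha _.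
  by rewrite linearD /= mulrDl scalerDl.
linear_combination R.
Qed.

Lemma split_wedgeDr v w w' : split_wedge v w -> split_wedge v w' -> split_wedge v (w + w').
Proof.
rewrite /split_wedge => Nv Nv'; have := commD Nv Nv'; congr comm_span.
rewrite linearD /= sigmaRD (wedgeDr wedge_alt).
have -> : zform v (w + w') = zform v w + zform v w'.
  rewrite /zform -big_split; apply: eq_bigr => alpha _.
  by rewrite linearD /= mulrDr scalerDl.
linear_combination R.
Qed.

Lemma split_wedgeZl a v w : split_wedge v w -> split_wedge (a *: v) w.
Proof.
rewrite /split_wedge => /(commZ a); congr comm_span.
rewrite lieZl sigmaRZ (wedgeZl wedge_alt).
have -> : zform (a *: v) w = a *: zform v w.
  rewrite /zform scaler_sumr; apply: eq_bigr => alpha _.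
  by rewrite linearZ /= scalerA mulrA.
linear_combination R.
Qed.

Lemma split_wedgeZr a v w : split_wedge v w -> split_wedge v (a *: w).
Proof.
rewrite /split_wedge => /(commZ a); congr comm_span.
rewrite linearZ /= sigmaRZ (wedgeZr wedge_alt).
have -> : zform v (a *: w) = a *: zform v w.
  rewrite /zform scaler_sumr; apply: eq_bigr => alpha _.
  by rewrite linearZ /= scalerA mulrCA.
linear_combination R.
Qed.

Lemma cR_hR alpha v : alpha \in rts -> cR alpha (hR v) = 0.
Proof.
move=> ar; rewrite /hR linearB linear_sum /= (bigD1_seq alpha) //=.
rewrite big_seq_cond big1 => [|beta /andP[br ba]].
  by rewrite linearZ /= cR_xR // eqxx addr0 [_ *: _]mulr1 subrr.
by rewrite linearZ /= cR_xR // eq_sym (negPf ba) scaler0.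
Qed.

Lemma zform_hl v w : zform (hR v) w = 0.
Proof.
by rewrite /zform big_seq big1 // => alpha ar; rewrite cR_hR // mul0r scale0r.
Qed.

Lemma zform_hr v w : zform v (hR w) = 0.
Proof.
by rewrite /zform big_seq big1 // => alpha ar; rewrite cR_hR ?rtsN // mulr0 scale0r.
Qed.

Lemma zform_xx alpha beta : alpha \in rts -> beta \in rts ->
  zform (xR alpha) (xR beta) = if beta == - alpha then zR alpha else 0.
Proof.
move=> ar br; rewrite /zform (bigD1_seq alpha) //= !cR_xR ?rtsN // eqxx mul1r.
rewrite big_seq_cond big1 => [|gamma /andP[gr ga]].
  by rewrite addr0 eq_sym; case: eqP => _; rewrite ?scale1r ?scale0r.
by rewrite !cR_xR ?rtsN // (negPf ga) mul0r scale0r.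
Qed.

(** [t - (alpha t / 2) H_alpha] commutes with [x_alpha]. *)
Lemma torus_wedge t (n : int) alpha : hZ t -> alpha \in rts -> (alpha t : F) = n%:~R ->
  comm_span (wedge (tR t) (xR alpha) - (n%:~R * u2) *: wedge (tR (H alpha)) (xR alpha)).
Proof.
move=> th ar tn.
rewrite -(wedgeZl wedge_alt) -(wedgeNl wedge_alt) -(wedgeDl wedge_alt).
apply: commuting_span; rewrite lieDl lieNl lieZl (lie_tR_xR th ar tn).
rewrite (@lie_tR_xR _ 2) ?coroot_root //; last exact: hZ_coroot.
by linear_coefs R; rewrite !mulr1 -[2%:~R]/(2%:R) -mulrA [u2 * _]mulrC u2E mulr1 subrr.
Qed.

Lemma iter_lie_i (k : nat) x y : gZ x -> gZ y ->
  iter k (lie (i x)) (i y) = i (iter k (lie x) y).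
Proof.
move=> xZ yZ; have itZ : forall l, gZ (iter l (lie x) y).
  by elim=> [|l IHl] //=; apply: gZ_lie.
by elim: k => [|k IHk] //=; rewrite IHk gR_lie.
Qed.

Lemma split_wedge_hh v w : split_wedge (hR v) (hR w).
Proof.
rewrite /split_wedge lie_hR_hR zform_hl sigmaR0 !subr0.
by apply: commuting_span; apply: lie_hR_hR.
Qed.

Lemma split_wedge_hx v alpha : alpha \in rts -> split_wedge (hR v) (xR alpha).
Proof.
move=> ar; rewrite /split_wedge zform_hl subr0 lie_hR_xR // sigmaRZ sigmaR_xR //.
rewrite scalerA -(wedgeZl wedge_alt) -(wedgeNl wedge_alt) -(wedgeDl wedge_alt).
apply: commuting_span; rewrite lieDl lieNl lieZl lie_hR_xR //.
rewrite (@lie_tR_xR _ 2) ?coroot_root //; last exact: hZ_coroot.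
by linear_coefs R; rewrite !mulr1 -[2%:~R]/(2%:R) -mulrA [u2 * _]mulrC u2E mulr1 subrr.
Qed.

Lemma split_wedge_xh v alpha : alpha \in rts -> split_wedge (xR alpha) (hR v).
Proof.
move=> /(split_wedge_hx v) /(commZ (- 1)); rewrite /split_wedge zform_hl zform_hr.
congr comm_span; rewrite (wedgeC wedge_alt (xR _)) [lie (xR _) _]lieC -[- lie _ _]scaleN1r sigmaRZ.
linear_combination R.
Qed.

(** [wedge_derivation] for [t = 2 H_alpha - <beta, alpha> H_beta], which is killed
    by [beta] and has at [alpha] the value [4 - <alpha, beta> <beta, alpha>], a unit
    of [R]; the wedge of [t] with the bracket is then computed by [torus_wedge]. *)
Lemma split_wedge_root alpha beta : alpha \in rts -> beta \in rts ->
  indep alpha beta -> alpha + beta \in rts -> split_wedge (xR alpha) (xR beta).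
Proof.
move=> ar br ab abr; have ab' : indep beta alpha by rewrite indep_sym.
have [n [nE n0 n3]] := structure_constant ar br ab' abr.
pose t : subvs_of h := H alpha *~ 2 - H beta *~ cart beta alpha.
pose b : int := 4 - cart alpha beta * cart beta alpha.
have [_ mn _] := cart_bounds br ar ab.
have th : hZ t by rewrite /t -mulrNz; apply: hZD; apply/hZMz/hZ_coroot.
have tE lam : lam \in rts ->
    (lam t : F) = (cart lam alpha * 2 - cart lam beta * cart beta alpha)%:~R.
  by move=> lr; rewrite /t linearB !raddfMz /= !cartE // intrB !intrM !mulrzr mulNrz.
have ta : (alpha t : F) = b%:~R by rewrite tE // cart_self.
have tb : (beta t : F) = 0%:~R by rewrite tE // cart_self // mulrC subrr.
have tab : ((alpha + beta) t : F) = b%:~R by rewrite add_lfunE ta tb addr0.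
have lieE : lie (xR alpha) (xR beta) = n%:~R *: xR (alpha + beta).
  by rewrite /xR gR_lie ?nE ?iZ //; exact: gZ_X.
rewrite /split_wedge zform_xx // indep_sym /indep in ab *; case/andP: ab => _ /negPf ->.
rewrite subr0 lieE sigmaRZ sigmaR_xR // scalerA.
apply: (@comm_unit b%:~R); first by apply: small_unit; rewrite /b; clear -mn; lia.
have lte : lie (tR t) (xR alpha) = b%:~R *: xR alpha by apply: lie_tR_xR.
have lty : lie (tR t) (xR beta) = 0 by rewrite (lie_tR_xR th br tb) scale0r.
have ad4 : iter 4 (lie (xR alpha)) (xR beta) = 0.
  by rewrite /xR iter_lie_i ?ad_X_pow4 ?i0 //; apply: gZ_X.
have N1 := wedge_derivation wedge_alt u2E u3E lte lty ad4.
have N2 := commZ (n%:~R) (torus_wedge th abr tab).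
have := commB N2 N1; congr comm_span; rewrite lieE (wedgeZr wedge_alt).
linear_combination R.
Qed.

Lemma split_wedge_xx alpha beta : alpha \in rts -> beta \in rts ->
  split_wedge (xR alpha) (xR beta).
Proof.
move=> ar br; have [ab|ab] := eqVneq beta (- alpha).
  rewrite /split_wedge zform_xx // ab eqxx lie_xR_xRN // -[- tR _]scaleN1r sigmaRZ.
  rewrite sigmaR_tR; last exact: hZ_coroot.
  by rewrite scaler0 subr0 subrr; apply: comm0.
have [abr|abN] := boolP (alpha + beta \in rts).
  apply: split_wedge_root => //; rewrite indep_sym /indep ab andbT.
  apply/eqP => ba; move: abr; rewrite ba.
  by rewrite -[alpha + alpha]/(alpha *~ 2) (negPf (no_root_multiple 0 ar)).
rewrite /split_wedge zform_xx // (negPf ab) /xR gR_lie; try exact: gZ_X.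
have lie0 : lie (X alpha) (X beta) = 0.
  apply: (lie_XX_nonroot (X_mem ar) (X_mem br)).
  by rewrite inE negb_or abN andbT addr_eq0 -eqr_oppLR eq_sym.
rewrite lie0 i0 sigmaR0 !subr0; apply: commuting_span.
by rewrite gR_lie ?lie0 ?i0 //; apply: gZ_X.
Qed.

Lemma split_wedge_all v w : split_wedge v w.
Proof.
have x_sum (P : gR -> Prop) : P 0 -> (forall y z : gR, P y -> P z -> P (y + z)) ->
    (forall alpha a, alpha \in rts -> P (a *: xR alpha)) ->
    forall c : dual h -> R, P (\sum_(alpha <- rts) c alpha *: xR alpha).
  by move=> P0 PD Px c; rewrite big_seq; apply: big_ind => // alpha; apply: Px.
have l0 (y : gR) : split_wedge 0 y.
  rewrite /split_wedge (wedge0l wedge_alt) lie0l sigmaR0 -[X in zform X](linear0 hR).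
  by rewrite zform_hl !subr0; apply: comm0.
have r0 (y : gR) : split_wedge y 0.
  rewrite /split_wedge (wedge0r wedge_alt) linear0 sigmaR0 -[X in zform _ X](linear0 hR).
  by rewrite zform_hr !subr0; apply: comm0.
rewrite (hR_split v) (hR_split w).
apply: split_wedgeDl; apply: split_wedgeDr.
- exact: split_wedge_hh.
- apply: (x_sum (split_wedge (hR v))) => [|y z|alpha a ar] //; first exact: split_wedgeDr.
  by apply/split_wedgeZr/split_wedge_hx.
- apply: (x_sum (split_wedge^~ (hR w))) => [|y z|alpha a ar] //; first exact: split_wedgeDl.
  by apply/split_wedgeZl/split_wedge_xh.
apply: (x_sum (split_wedge^~ _)) => [|y z|alpha a ar] //; first exact: split_wedgeDl.
apply: split_wedgeZl.
apply: (x_sum (split_wedge (xR alpha))) => [|y z|beta b br] //; first exact: split_wedgeDr.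
by apply/split_wedgeZr/split_wedge_xx.
Qed.

(** * Weight zero and the simple roots *)

(** For a commuting pair the part of nonzero weight is congruent to
    [sigmaR 0 = 0]. *)
Lemma zform_commuting v w : lie v w = 0 -> comm_span (zform v w).
Proof.
move=> vw; have := commB (commuting_span wedge vw) (split_wedge_all v w); congr comm_span.
rewrite vw sigmaR0; linear_combination R.
Qed.

Variable ht : dual h -> int.
Hypothesis htD : {in rts &, forall alpha beta, alpha + beta \in rts ->
  ht (alpha + beta) = ht alpha + ht beta}.
Hypothesis htN : {in rts, forall alpha, ht (- alpha) = - ht alpha}.
Hypothesis ht_neq0 : {in rts, forall alpha, ht alpha != 0}.

Definition decomposition alpha beta :=
  [&& 0 < ht beta, alpha - beta \in rts & 0 < ht (alpha - beta)].

Definition simple alpha := (0 < ht alpha) && ~~ has (decomposition alpha) rts.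

Definition simples := [seq alpha <- rts | simple alpha].

Definition simple_mod (v : W) :=
  exists d : dual h -> R, comm_span (v - \sum_(alpha <- simples) d alpha *: zR alpha).

Lemma simple_mod_comm v : comm_span v -> simple_mod v.
Proof.
move=> Nv; exists (fun=> 0); rewrite big1 ?subr0 // => alpha _.
by rewrite scale0r.
Qed.

Lemma simple_modD v w : simple_mod v -> simple_mod w -> simple_mod (v + w).
Proof.
move=> [d Nd] [d' Nd']; exists (fun alpha => d alpha + d' alpha).
have := commD Nd Nd'; rewrite addrACA -opprD -big_split /=; congr (comm_span (_ - _)).
by apply: eq_bigr => alpha _; rewrite scalerDl.
Qed.

Lemma simple_modZ a v : simple_mod v -> simple_mod (a *: v).
Proof.
move=> [d Nd]; exists (fun alpha => a * d alpha); have := commZ a Nd.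
rewrite scalerBr scaler_sumr; congr (comm_span (_ - _)).
by apply: eq_bigr => alpha _; rewrite scalerA.
Qed.

Lemma simple_mod_sum (I : eqType) (r : seq I) (P : pred I) (v : I -> W) :
  (forall k, k \in r -> P k -> simple_mod (v k)) -> simple_mod (\sum_(k <- r | P k) v k).
Proof.
move=> vS; rewrite big_seq_cond; apply: big_ind => [|x y|k /andP[kr Pk]].
- exact/simple_mod_comm/comm0.
- exact: simple_modD.
exact: vS.
Qed.

Lemma simple_mod_simple alpha : alpha \in simples -> simple_mod (zR alpha).
Proof.
move=> aS; exists (fun beta => (beta == alpha)%:R).
rewrite (bigD1_seq alpha) ?filter_uniq //= eqxx scale1r big1 ?addr0 ?subrr => [|beta /negPf ->].
  exact: comm0.
by rewrite scale0r.
Qed.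

(** The relation given by the commuting pair of the triangle has the coefficient
    [- 36 tri_k n * 36] at [z_delta], a product of units. *)
Lemma simple_mod_triangle beta gamma : beta \in rts -> gamma \in rts -> indep gamma beta ->
  beta + gamma \in rts -> simple_mod (zR beta) -> simple_mod (zR gamma) ->
  simple_mod (zR (beta + gamma)).
Proof.
move=> br gr gb dr zb zg; have [n [nE n0 n3]] := structure_constant br gr gb dr.
have [xZ yZ] := tri_gZ br gr dr.
have xy : lie (i (tri_x beta gamma)) (i (tri_y beta gamma)) = 0.
  by rewrite gR_lie ?tri_commute ?i0.
have := zform_commuting xy; rewrite /zform (bigD1_seq (beta + gamma)) //=.
rewrite (cRE dr xZ (tri_x_delta br gr gb dr nE)).
rewrite (@cRE _ _ 36 (rtsN dr) yZ); last by rewrite tri_y_delta.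
set k := _ * _ => Nk.
have [u uk] : exists u, u * k = 1.
  have kb := tri_k_bounds br gr gb dr.
  have [v vE] : exists v : R, v * (tri_k beta gamma)%:~R = 1.
    by apply: small_unit; clear -kb; lia.
  have [w wE] : exists w : R, w * n%:~R = 1 by apply: small_unit; clear -n0 n3; lia.
  pose c := u2 * u2 * (u3 * u3); have cE : c * 36%:~R = 1.
    have -> : c * 36%:~R = (2%:R * u2) * (2%:R * u2) * ((3%:R * u3) * (3%:R * u3)).
      by rewrite /c; ring.
    by rewrite u2E u3E !mulr1.
  exists (- (c * c * v * w)).
  transitivity ((c * 36%:~R) * (c * 36%:~R) * (v * (tri_k beta gamma)%:~R) * (w * n%:~R)).
    by rewrite /k !(intrN, intrM); ring.
  by rewrite cE vE wE !mulr1.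
have -> : zR (beta + gamma) = u *: (k *: zR (beta + gamma)) by rewrite scalerA uk scale1r.
apply: simple_modZ; move: Nk; set s := \sum_(_ <- _ | _) _ => Nk.
have -> : k *: zR (beta + gamma) = (k *: zR (beta + gamma) + s) + (- 1) *: s.
  linear_combination R.
apply: simple_modD; first exact: simple_mod_comm.
apply/simple_modZ/simple_mod_sum => alpha ar ad.
have [->|ab] := eqVneq alpha beta; first exact: simple_modZ.
have [->|ag] := eqVneq alpha gamma; first exact: simple_modZ.
have [x0|y0] := tri_support br gr gb dr ar ab ag ad.
  by rewrite (@cRE _ _ 0 ar xZ) // mul0r scale0r; apply/simple_mod_comm/comm0.
by rewrite (@cRE _ _ 0 (rtsN ar) yZ) // mulr0 scale0r; apply/simple_mod_comm/comm0.
Qed.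

Lemma simple_mod_positive (m : nat) alpha : alpha \in rts -> 0 < ht alpha -> ht alpha <= m ->
  simple_mod (zR alpha).
Proof.
elim: m alpha => [|m IHm] alpha ar a0 am; first by clear -a0 am; lia.
have [/hasP[beta br /and3P[b0 abr ab0]]|aS] := boolP (has (decomposition alpha) rts); last first.
  by apply: simple_mod_simple; rewrite mem_filter /simple a0 aS ar.
have aE : alpha = beta + (alpha - beta) by rewrite addrC subrK.
have hE : ht alpha = ht beta + ht (alpha - beta) by rewrite {1}aE htD // -aE.
rewrite aE; apply: simple_mod_triangle => //; rewrite -?aE //.
- apply/andP; split; last by rewrite subr_eq addNr rts_neq0.
  rewrite subr_eq; apply/eqP => E; have := no_root_multiple 0 br.
  by rewrite -[beta *~ 2]/(beta + beta) -E ar.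
- by apply: IHm => //; clear -am hE ab0; lia.
by apply: IHm => //; clear -am hE b0; lia.
Qed.

Lemma simple_mod_zR alpha : alpha \in rts -> simple_mod (zR alpha).
Proof.
move=> ar; have := ht_neq0 ar; rewrite neq_lt => /orP[a0|a0].
  rewrite -[alpha]opprK zR_opp -scaleN1r; apply: simple_modZ.
  by apply: (@simple_mod_positive `|ht alpha|%N); rewrite ?rtsN // htN //; clear -a0; lia.
by apply: (@simple_mod_positive `|ht alpha|%N) => //; clear -a0; lia.
Qed.

(** If the difference were a root, one of the two simple roots would be the sum of
    the other and of a positive root. *)
Lemma simple_sub alpha beta : alpha \in simples -> beta \in simples -> alpha != beta ->
  alpha - beta \notin 0 :: rts.
Proof.
rewrite !mem_filter => /andP[/andP[a0 aS] ar] /andP[/andP[b0 bS] br] ab.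
rewrite inE negb_or subr_eq0 ab /=; apply/negP => abr.
have := ht_neq0 abr; rewrite neq_lt => /orP[ab0|ab0].
  case/negP: bS; apply/hasP; exists alpha => //; rewrite /decomposition a0 /=.
  by rewrite -(opprB alpha beta) rtsN // htN // oppr_gt0.
by case/negP: aS; apply/hasP; exists beta => //; rewrite /decomposition b0 abr.
Qed.

(** The bracket of [x] and [y] reduces to the sum in the hypothesis, since the
    remaining brackets have the weight of a difference of simple roots. *)
Lemma simple_kernel (d : dual h -> R) :
  \sum_(alpha <- simples) d alpha *: lie (xR alpha) (xR (- alpha)) = 0 ->
  comm_span (\sum_(alpha <- simples) d alpha *: zR alpha).
Proof.
move=> d0; have Sr alpha : alpha \in simples -> alpha \in rts.
  by rewrite mem_filter => /andP[].
pose x := \sum_(alpha <- simples) d alpha *: xR alpha.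
pose y := \sum_(beta <- simples) xR (- beta).
have S_uniq : uniq simples by rewrite filter_uniq.
have lie0 alpha beta : alpha \in simples -> beta \in simples -> beta != alpha ->
    lie (xR alpha) (xR (- beta)) = 0.
  move=> aS bS ba; have [ar br] := (Sr _ aS, Sr _ bS).
  rewrite /xR gR_lie ?(lie_XX_nonroot (X_mem ar) (X_mem (rtsN br))) ?i0 //.
  - by apply: simple_sub; rewrite // eq_sym.
  - exact: gZ_X.
  exact/gZ_X/rtsN.
have xy : lie x y = 0.
  rewrite -d0 /x lie_suml big_seq [RHS]big_seq; apply: eq_bigr => alpha aS.
  rewrite lieZl /y linear_sum (bigD1_seq alpha) //= big_seq_cond big1 ?addr0 // => beta.
  by move=> /andP[bS ba]; apply: lie0.
have -> : \sum_(alpha <- simples) d alpha *: zR alpha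
    = wedge x y - \sum_(alpha <- simples) d alpha *:
        \sum_(beta <- simples | beta != alpha) wedge (xR alpha) (xR (- beta)).
  apply/eqP; rewrite eq_sym subr_eq; apply/eqP.
  rewrite /x (wedge_suml wedge_alt) -big_split big_seq [RHS]big_seq /=.
  apply: eq_bigr => alpha aS; rewrite (wedgeZl wedge_alt) -scalerDr; congr (_ *: _).
  by rewrite /y (wedge_sumr wedge_alt) (bigD1_seq alpha).
apply: commB; first exact: commuting_span.
rewrite big_seq; apply: combination_sum => alpha aS; apply: commZ.
rewrite big_seq_cond; apply: combination_sum => beta /andP[bS ba].
by apply: commuting_span; apply: lie0.
Qed.

Variable bracket : {linear W -> gR}.
Hypothesis bracketE : forall x y : gR, bracket (wedge x y) = lie x y.

Lemma bracket_commuting v : comm_span v -> bracket v = 0.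
Proof.
move=> [n [c [x [xN ->]]]]; rewrite linear_sum big1 // => k _.
by have [y [z [yz ->]]] := xN k; rewrite linearZ /= bracketE yz scaler0.
Qed.

Lemma wedge_span_ind (P : W -> Prop) :
  (forall v w, P v -> P w -> P (v + w)) -> (forall a v, P v -> P (a *: v)) ->
  (forall x y : gR, P (wedge x y)) -> forall w, P w.
Proof.
move=> PD PZ Pwedge w; have [n [E [c vE]]] := finitely_spanned.
have [a ->] := exterior_spanned wedge_alt W_exterior u2E vE w.
have P0 : P 0 by rewrite -(wedge0l wedge_alt 0).
by apply: big_ind => // k _; apply: big_ind => // l _; apply: PZ.
Qed.

Lemma kernel_commuting w : bracket w = 0 -> comm_span w.
Proof.
have main v : simple_mod (v - sigmaR (bracket v)).
  apply: (wedge_span_ind (P := fun v => simple_mod (v - sigmaR (bracket v))))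
    => [{}v v' vS v'S|a {}v vS|x y].
  - have := simple_modD vS v'S; congr simple_mod.
    rewrite linearD /= sigmaRD; linear_combination R.
  - have := simple_modZ a vS; congr simple_mod.
    rewrite linearZ /= sigmaRZ; linear_combination R.
  have -> : wedge x y - sigmaR (bracket (wedge x y))
      = (wedge x y - sigmaR (lie x y) - zform x y) + zform x y.
    by rewrite bracketE subrK.
  apply: simple_modD; first exact/simple_mod_comm/split_wedge_all.
  by apply: simple_mod_sum => alpha ar _; apply/simple_modZ/simple_mod_zR.
move=> w0; have [d] := main w; rewrite w0 sigmaR0 subr0 => Nd.
have := bracket_commuting Nd; rewrite linearB linear_sum w0 sub0r => /eqP.
rewrite oppr_eq0 => /eqP d0.
rewrite -(subrK (\sum_(alpha <- simples) d alpha *: zR alpha) w); apply: commD => //.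
apply: simple_kernel; rewrite -[RHS]d0; apply: eq_bigr => alpha _.
by rewrite linearZ /= bracketE.
Qed.

End RootSystem.

Theorem theorem6p4
  (F : fieldType) (charF : [pchar F] =i pred0)
  (g : vectLieAlgType F) (g_reductive : is_reductive g)
  (h : {vspace g}) (h_split : is_split_cartan h)
  (H : dual h -> subvs_of h)
  (H_coroot : forall alpha : dual h, is_root alpha -> is_coroot alpha (H alpha))
  (X : dual h -> g) (X_chevalley : is_chevalley_system H X)
  (hZ : subvs_of h -> Prop) (hZ_lattice : is_lattice hZ)
  (hZ_lower : forall t, coroot_lattice H t -> hZ t)
  (hZ_upper : forall t, hZ t ->
     exists p z : subvs_of h,
       [/\ coweight_lattice H p, in_center (vsval z) & t = p + z])
  (R : comPzRingType)
  (two_inv : exists u : R, 2%:R * u = 1)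
  (three_inv : exists u : R, 3%:R * u = 1)
  (gR : lieAlgType R) (i : g -> gR)
  (gR_base_change : is_base_change (chevalley_order hZ X) i)
  (gR_lie : forall x y, chevalley_order hZ X x -> chevalley_order hZ X y ->
     lie (i x) (i y) = i (lie x y))
  (W : lmodType R) (wedge : gR -> gR -> W)
  (W_exterior : is_exterior_square wedge)
  (bracket : {linear W -> gR})
  (bracketE : forall x y, bracket (wedge x y) = lie x y)
  (w : W) :
  bracket w = 0 <->
  lin_span (fun v => exists x y : gR, lie x y = 0 /\ v = wedge x y) w.
Proof.
have [u2 u2E] := two_inv; have [u3 u3E] := three_inv.
have [rts [pi [rts_uniq rtsP pi_mem pi_root pi_sum]]] := weight_decomposition h_split.
split; last exact: bracket_commuting bracketE _.
have [ht [htD htN ht_neq0]] := exists_height charF h_split H_coroot X_chevalley rts_uniq rtsP.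
exact: (kernel_commuting charF h_split H_coroot X_chevalley rts_uniq rtsP pi_mem pi_root
  pi_sum hZ_lattice hZ_lower hZ_upper gR_base_change gR_lie u2E u3E W_exterior
  htD htN ht_neq0 bracketE).
Qed.
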